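(* Let $1<p\le 2$, let $\Omega\subset\mathbb{R}^n$ be open, bounded and connected with $C^2$ boundary, and let $f:\overline{\Omega}\to\mathbb{R}$ be nonnegative and Lipschitz with $f=0$ on $\partial\Omega$. Put $\alpha=\frac{2-p}{p-1}$. For $\varepsilon\in(0,1)$ let $u^\varepsilon\in C^2(\Omega)$ be the unique solution of the large-solution problem $(\mathrm{PDE}_\varepsilon)$ and let $u\in C(\overline{\Omega})$ be the unique solution of the state-constraint problem $(\mathrm{PDE}_0)$. Then there exists a constant $C$ independent of $\varepsilon\in(0,1)$ such that for all $x\in\Omega$: $$-C\sqrt{\varepsilon}\le u^\varepsilon(x)-u(x)\le C\left(\sqrt{\varepsilon}+\frac{\varepsilon^{\alpha+1}}{d(x)^\alpha}\right)\quad\text{if }1<p<2,$$ $$-C\sqrt{\varepsilon}\le u^\varepsilon(x)-u(x)\le C\left(\sqrt{\varepsilon}+\varepsilon|\log(d(x))|\right)\quad\text{if }p=2.$$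
   Context: $(\mathrm{PDE}_\varepsilon)$: $u^\varepsilon\in C^2(\Omega)$ satisfies $u^\varepsilon+|Du^\varepsilon|^p-f-\varepsilon\Delta u^\varepsilon=0$ in $\Omega$ and $u^\varepsilon(x)\to+\infty$ as $\mathrm{dist}(x,\partial\Omega)\to0$; this problem has a unique solution for $1<p\le2$. $(\mathrm{PDE}_0)$: $u\in C(\overline\Omega)$ is a viscosity subsolution of $u+|Du|^p-f\le0$ in $\Omega$ and a viscosity supersolution of $u+|Du|^p-f\ge0$ on $\overline\Omega$. The latter means: whenever $\varphi\in C^1(\overline\Omega)$ and $u-\varphi$ attains its minimum over $\overline\Omega$ at a point $x_0\in\overline\Omega$ (possibly on $\partial\Omega$), then $u(x_0)+|D\varphi(x_0)|^p-f(x_0)\ge0$. This problem has a unique solution in $C(\overline\Omega)$. Function $d$: for small $\delta>0$ let $\Omega_\delta=\{x\in\Omega:\mathrm{dist}(x,\partial\Omega)>\delta\}$ and $\Omega^\delta=\{x\in\mathbb{R}^n:\mathrm{dist}(x,\overline\Omega)<\delta\}$. Let $\rho$ be the signed distance to $\partial\Omega$: $\rho(x)=\mathrm{dist}(x,\partial\Omega)$ for $x\in\overline\Omega$ and $\rho(x)=-\mathrm{dist}(x,\partial\Omega)$ for $x\notin\overline\Omega$. Let $\delta_0=\frac12\sup\{\delta>0:\rho\text{ is }C^2\text{ in }\Omega^\delta\setminus\overline{\Omega}_\delta\}$. Then $d\in C^2(\mathbb{R}^n)$ is a fixed function with $d=\rho$ on $\Omega^{\delta_0}\setminus\Omega_{\delta_0}$,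 $d>0$ in $\Omega$, and $d\le0$ outside $\Omega$. *)

(* Defs.v *)
From mathcomp Require Import all_boot all_order all_algebra.
From mathcomp Require Import all_classical all_reals all_analysis.
Set Implicit Arguments.
Unset Strict Implicit.
Unset Printing Implicit Defensive.
Import Order.TTheory GRing.Theory Num.Theory.
Import numFieldNormedType.Exports.
Local Open Scope classical_set_scope.
Local Open Scope ring_scope.

(** R^n is ['rV[R]_n].  The library norm on it is the sup norm, which has the
    right topology; every metric quantity below uses the Euclidean norm. *)
Definition enorm (R : realType) (n : nat) (x : 'rV[R]_n) : R :=
  Num.sqrt (\sum_(i < n) x 0 i ^+ 2).

Definition dist_to (R : realType) (n : nat) (A : set 'rV[R]_n) (x : 'rV[R]_n) : R :=
  inf [set enorm (x - y) | y in A].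

Definition boundary (R : realType) (n : nat) (Om : set 'rV[R]_n) : set 'rV[R]_n :=
  closure Om `\` interior Om.

Definition partial (R : realType) (n : nat) (i : 'I_n) (g : 'rV[R]_n -> R) :
    'rV[R]_n -> R :=
  fun x => 'D_(delta_mx 0 i) g x.

Definition grad (R : realType) (n : nat) (g : 'rV[R]_n -> R) (x : 'rV[R]_n) : 'rV[R]_n :=
  \row_i partial i g x.

Definition laplacian (R : realType) (n : nat) (g : 'rV[R]_n -> R) (x : 'rV[R]_n) : R :=
  \sum_(i < n) partial i (partial i g) x.

(** [C1_on A] and [C2_on A] are meant for open [A]. *)
Definition C1_on (R : realType) (n : nat) (A : set 'rV[R]_n) (g : 'rV[R]_n -> R) : Prop :=
  forall x, A x -> differentiable g x /\
    forall i, {for x, continuous (partial i g)}.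

Definition C2_on (R : realType) (n : nat) (A : set 'rV[R]_n) (g : 'rV[R]_n -> R) : Prop :=
  C1_on A g /\ forall i, C1_on A (partial i g).

(** [g] is of class C^1 on [closure Om], i.e. [g] is C^1 in the open set [Om] and
    [g] and its gradient extend continuously to [closure Om].  [Dg] is that
    extension of the gradient; it is uniquely determined on [closure Om]. *)
Definition C1_closure (R : realType) (n : nat) (Om : set 'rV[R]_n)
    (g : 'rV[R]_n -> R) (Dg : 'rV[R]_n -> 'rV[R]_n) : Prop :=
  [/\ {within closure Om, continuous g},
      C1_on Om g,
      forall x, Om x -> grad g x = Dg x &
      {within closure Om, continuous Dg}].

(** Near each boundary point, up to the choice of the coordinate axis [k] and of
    its orientation [s], [Om] lies above the graph of a C^2 function of the
    other [n - 1] coordinates. *)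
Definition C2_boundary (R : realType) (n : nat) (Om : set 'rV[R]_n) : Prop :=
  forall x0, boundary Om x0 ->
  exists r : R, 0 < r /\
  exists (k : 'I_n) (s : bool) (gamma : 'rV[R]_(n.-1) -> R),
    C2_on setT gamma /\
    forall x, enorm (x - x0) < r ->
      (Om x <-> gamma (col' k x) < (-1) ^+ s * x 0 k).

Definition lipschitz_euclid (R : realType) (n : nat) (A : set 'rV[R]_n)
    (g : 'rV[R]_n -> R) : Prop :=
  exists L : R, forall x y, A x -> A y -> `|g x - g y| <= L * enorm (x - y).

Definition is_PDE_eps_solution (R : realType) (n : nat) (Om : set 'rV[R]_n) (p : R)
    (f : 'rV[R]_n -> R) (eps : R) (v : 'rV[R]_n -> R) : Prop :=
  [/\ C2_on Om v,
      forall x, Om x ->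
        v x + enorm (grad v x) `^ p - f x - eps * laplacian v x = 0 &
      forall M : R, exists2 delta : R, 0 < delta &
        forall x, Om x -> dist_to (boundary Om) x < delta -> M < v x].

Definition viscosity_subsolution (R : realType) (n : nat) (Om : set 'rV[R]_n) (p : R)
    (f u : 'rV[R]_n -> R) : Prop :=
  forall phi : 'rV[R]_n -> R, C1_on Om phi ->
  forall x0, Om x0 ->
    (forall x, Om x -> u x - phi x <= u x0 - phi x0) ->
    u x0 + enorm (grad phi x0) `^ p - f x0 <= 0.

Definition viscosity_supersolution_closure (R : realType) (n : nat)
    (Om : set 'rV[R]_n) (p : R) (f u : 'rV[R]_n -> R) : Prop :=
  forall (phi : 'rV[R]_n -> R) (Dphi : 'rV[R]_n -> 'rV[R]_n),
    C1_closure Om phi Dphi ->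
  forall x0, closure Om x0 ->
    (forall x, closure Om x -> u x0 - phi x0 <= u x - phi x) ->
    0 <= u x0 + enorm (Dphi x0) `^ p - f x0.

Definition is_PDE0_solution (R : realType) (n : nat) (Om : set 'rV[R]_n) (p : R)
    (f u : 'rV[R]_n -> R) : Prop :=
  [/\ {within closure Om, continuous u},
      viscosity_subsolution Om p f u &
      viscosity_supersolution_closure Om p f u].

Definition inner_set (R : realType) (n : nat) (Om : set 'rV[R]_n) (delta : R) :
    set 'rV[R]_n :=
  [set x | Om x /\ delta < dist_to (boundary Om) x].

Definition outer_set (R : realType) (n : nat) (Om : set 'rV[R]_n) (delta : R) :
    set 'rV[R]_n :=
  [set x | dist_to (closure Om) x < delta].

Definition signed_dist (R : realType) (n : nat) (Om : set 'rV[R]_n) (x : 'rV[R]_n) : R :=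
  if `[< closure Om x >] then dist_to (boundary Om) x else - dist_to (boundary Om) x.

Definition delta0 (R : realType) (n : nat) (Om : set 'rV[R]_n) : R :=
  2^-1 * sup [set delta : R | 0 < delta /\
    C2_on (outer_set Om delta `\` closure (inner_set Om delta)) (signed_dist Om)].

Definition is_extended_dist (R : realType) (n : nat) (Om : set 'rV[R]_n)
    (d : 'rV[R]_n -> R) : Prop :=
  [/\ C2_on setT d,
      forall x, (outer_set Om (delta0 Om) `\` inner_set Om (delta0 Om)) x ->
        d x = signed_dist Om x,
      forall x, Om x -> 0 < d x &
      forall x, ~ Om x -> d x <= 0].

(* Main.v *)
Require Import Defs.
From mathcomp Require Import all_boot all_order all_algebra.
From mathcomp Require Import all_classical all_reals all_analysis.
From mathcomp Require Import ring lra.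
Set Implicit Arguments.
Unset Strict Implicit.
Unset Printing Implicit Defensive.
Import Order.TTheory GRing.Theory Num.Theory.
Import numFieldNormedType.Exports.
Local Open Scope classical_set_scope.
Local Open Scope ring_scope.

(** The two one-sided estimates rest on the fact that [f >= 0] and [f = 0] on the
    boundary force [0 <= u <= f], hence [u = 0] on the boundary, while the large
    solutions are nonnegative ([state_constraint_ge0], [subsolution_le_closure],
    [large_solution_ge0]).

    For the lower bound, one doubles variables with the penalization
    [|x - y|^2 / (2 * sqrt eps)].  The large solution is infinite on the boundary,
    which keeps its variable inside, and [u = 0] settles the case where the other
    variable is on the boundary.  At an interior maximum the two equations share
    the same gradient, so what remains is the diffusion term, of order [sqrt eps],
    and the oscillation of [f] at scale [sqrt eps] ([large_solution_lower_bound]).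

    For the upper bound the same doubling works with [u] as a supersolution up to
    the boundary, as long as the variable of the large solution stays at distance
    of order [sqrt eps] from the complement ([large_solution_upper_bound]).  In the
    remaining zone one uses [u >= 0] and bounds the large solution alone.  There
    [f] has order [sqrt eps], and the C^2 boundary provides a ball of radius of
    order [sqrt eps] inside the domain in which [x] is at a depth bounded below by
    a multiple of [d x] ([uniform_deep_ball]).  On this ball the large solution
    lies below the radial profile that blows up on the sphere like
    [eps^(alpha + 1) * dist^(-alpha)], or like [eps * |log dist|] when [p = 2], up to
    an error of order [sqrt eps] ([interior_ball_comparison], [zone_bound]).  The
    profile at depth of order [sqrt eps] is itself of order [sqrt eps]
    ([layer_sqrt_le]), so the two regions match.

    The function [d] enters only through [d x <= C * h], where [h] is the height of
    [x] above a boundary chart: this holds because [d] is C^1 and [d <= 0] outside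
    the domain. *)

(** * The Euclidean norm *)

Definition sqn (R : realType) (n : nat) (v : 'rV[R]_n) : R :=
  \sum_(i < n) v 0 i ^+ 2.

Lemma sqn_ge0 (R : realType) (n : nat) (v : 'rV[R]_n) : 0 <= sqn v.
Proof. by apply: sumr_ge0 => i _; exact: sqr_ge0. Qed.

Lemma enorm_ge0 (R : realType) (n : nat) (v : 'rV[R]_n) : 0 <= enorm v.
Proof. exact: sqrtr_ge0. Qed.

Lemma enorm_sqr (R : realType) (n : nat) (v : 'rV[R]_n) : enorm v ^+ 2 = sqn v.
Proof. by rewrite sqr_sqrtr ?sqn_ge0. Qed.

Lemma enorm_le (R : realType) (n : nat) (v : 'rV[R]_n) (r : R) :
  0 <= r -> (enorm v <= r) = (sqn v <= r ^+ 2).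
Proof.
by move=> r0; rewrite -enorm_sqr ler_pXn2r ?nnegrE ?enorm_ge0.
Qed.

Lemma enormZ (R : realType) (n : nat) (a : R) (v : 'rV[R]_n) :
  0 <= a -> enorm (a *: v) = a * enorm v.
Proof.
move=> a0; rewrite /enorm.
under eq_bigr do rewrite mxE exprMn.
by rewrite -mulr_sumr sqrtrM ?sqr_ge0// sqrtr_sqr ger0_norm.
Qed.

Lemma sqnN (R : realType) (n : nat) (v : 'rV[R]_n) : sqn (- v) = sqn v.
Proof. by apply: eq_bigr => i _; rewrite mxE sqrrN. Qed.

Lemma enormB (R : realType) (n : nat) (x y : 'rV[R]_n) :
  enorm (x - y) = enorm (y - x).
Proof. by rewrite -opprB; congr Num.sqrt; exact: sqnN. Qed.

Lemma sqn0 (R : realType) (n : nat) : sqn (0 : 'rV[R]_n) = 0.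
Proof. by apply: big1 => i _; rewrite mxE expr0n. Qed.

Lemma sqr_coord_le (R : realType) (n : nat) (v : 'rV[R]_n) (i : 'I_n) :
  v 0 i ^+ 2 <= sqn v.
Proof.
by rewrite /sqn (bigD1 i)//= lerDl; apply: sumr_ge0 => j _; exact: sqr_ge0.
Qed.

Lemma coord_le_enorm (R : realType) (n : nat) (v : 'rV[R]_n) (i : 'I_n) :
  `|v 0 i| <= enorm v.
Proof.
by rewrite -sqrtr_sqr ler_sqrt ?sqr_coord_le// sqn_ge0.
Qed.

Lemma mx_norm_le (R : realType) (n : nat) (v : 'rV[R]_n) (r : R) :
  0 <= r -> (forall i, `|v 0 i| <= r) -> `|v| <= r.
Proof.
move=> r0 H; rewrite -[`|v|]/(mx_norm v) mx_normrE; apply/bigmax_leP; split => //=.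
by case=> i j _ /=; rewrite ord1.
Qed.

Lemma coord_le_norm (R : realType) (n : nat) (v : 'rV[R]_n) (i : 'I_n) :
  `|v 0 i| <= `|v|.
Proof.
rewrite -[`|v|]/(mx_norm v) mx_normrE.
by apply/bigmax_geP; right; exists (0, i).
Qed.

Lemma norm_le_enorm (R : realType) (n : nat) (v : 'rV[R]_n) : `|v| <= enorm v.
Proof. by apply: mx_norm_le; [exact: enorm_ge0 | exact: coord_le_enorm]. Qed.

Lemma sqn_le_norm (R : realType) (n : nat) (v : 'rV[R]_n) :
  sqn v <= n%:R * `|v| ^+ 2.
Proof.
apply: le_trans (_ : \sum_(i < n) `|v| ^+ 2 <= _).
  apply: ler_sum => i _; rewrite -[leLHS]real_normK ?num_real//.
  by rewrite lerXn2r ?nnegrE// coord_le_norm.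
by rewrite sumr_const card_ord mulr_natl.
Qed.

Lemma enorm_le_norm (R : realType) (n : nat) (v : 'rV[R]_n) :
  enorm v <= (n%:R + 1) * `|v|.
Proof.
rewrite enorm_le ?mulr_ge0// ?addr_ge0//.
apply: le_trans (sqn_le_norm v) _; rewrite exprMn ler_wpM2r ?sqr_ge0//.
by have := ler0n R n; nra.
Qed.

Lemma sqn_line (R : realType) (n : nat) (v : 'rV[R]_n) (i : 'I_n) (t : R) :
  sqn (v + t *: delta_mx 0 i) = sqn v + 2 * t * v 0 i + t ^+ 2.
Proof.
rewrite /sqn (bigD1 i)//= [in RHS](bigD1 i)//= !mxE !eqxx mulr1.
rewrite (eq_bigr (fun j => v 0 j ^+ 2)); last first.
  by move=> j ji; rewrite !mxE eqxx (negbTE ji) mulr0 addr0.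
ring.
Qed.

Lemma sqn_continuous (R : realType) (n : nat) : continuous (@sqn R n).
Proof.
move=> x; apply: differentiable_continuous.
rewrite (_ : @sqn R n = \sum_(i < n) (fun v : 'rV[R]_n => v 0 i : R) ^+ 2); last first.
  by apply/funext => v; rewrite fct_sumE; apply: eq_bigr.
by apply: differentiable_sum => i; apply: differentiableX; exact: differentiable_coord.
Qed.

(** * Second-order conditions at extrema *)

Lemma is_derive_line (R : realType) (n : nat) (g : 'rV[R]_n -> R) (x e : 'rV[R]_n)
    (t : R) :
  derivable g (x + t *: e) e ->
  is_derive t 1 (fun s => g (x + s *: e)) ('D_e g (x + t *: e)).
Proof.
have E : (fun h : R => h^-1 *: (((fun s => g (x + s *: e)) \o shift t) (h *: 1)
             - g (x + t *: e))) =
         (fun h => h^-1 *: ((g \o shift (x + t *: e)) (h *: e) - g (x + t *: e))).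
  apply/funext => h /=; congr (_ *: (g _ - _)).
  by rewrite [h%:A]mulr1 scalerDl addrCA.
by move=> d; apply: DeriveDef; rewrite /derivable /derive E.
Qed.

(** Second-order necessary condition: otherwise the derivative would be positive
    to the right of [0], and the function would increase there. *)
Lemma second_derivative_at_max (R : realType) (phi phi1 : R -> R) (c e : R) :
  0 < e -> (forall t : R, `|t| < e -> is_derive t 1 phi (phi1 t)) ->
  is_derive (0 : R) 1 phi1 c -> (forall t : R, `|t| < e -> phi t <= phi 0) ->
  phi1 0 = 0 /\ c <= 0.
Proof.
move=> e0 dphi dphi1 mx.
have p10 : phi1 0 = 0.
  have I : is_derive (0 : R) 1 phi 0.
    apply: (@derive1_at_max _ phi (- e) e 0).
    - lra.
    - move=> t; rewrite in_itv/= -ltr_norml => /dphi dt; exact: ex_derive.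
    - by rewrite in_itv/= oppr_lt0 e0.
    - by move=> t; rewrite in_itv/= -ltr_norml => /mx.
  have /dphi D : `|0 : R| < e by rewrite normr0.
  by rewrite -(@derive_val _ _ _ _ _ _ _ D) (@derive_val _ _ _ _ _ _ _ I).
split=> //; rewrite leNgt; apply/negP => c0.
have cv : h^-1 *: ((phi1 \o shift 0) (h *: 1) - phi1 0) @[h --> 0^'] --> c.
  by rewrite -(@derive_val _ _ _ _ _ _ _ dphi1); exact: (@ex_derive _ _ _ _ _ _ _ dphi1).
have /nbhs_ballP[r /= r0 rP] : \forall h \near 0^', 0 < h^-1 *: ((phi1 \o shift 0) (h *: 1) - phi1 0).
  exact: (cvgr_gt c cv).
have pos h : 0 < h -> h < r -> 0 < phi1 h.
  move=> h0 hr; have /= := rP h; rewrite p10 subr0 addr0 [_%:A]mulr1 => H.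
  have : 0 < h^-1 * phi1 h.
    by apply: H; rewrite ?gt_eqF//= /ball/= sub0r normrN gtr0_norm.
  by rewrite pmulr_rgt0 ?invr_gt0.
pose s := Num.min r e / 2.
have m0 : 0 < Num.min r e by rewrite lt_min r0.
have sr : s < r by rewrite /s; have := ge_min r r e; rewrite lexx /=; lra.
have se : s < e by rewrite /s; have := ge_min e r e; rewrite lexx orbT /=; lra.
have s0 : 0 < s by rewrite /s; lra.
have dphi' x : x \in `[0, s]%R -> is_derive x 1 phi (phi1 x).
  rewrite in_itv/= => /andP[x0 xs]; apply: dphi.
  by rewrite ger0_norm//; exact: le_lt_trans xs se.
have dphi'' (x : R) : x \in `]0, s[%R -> is_derive x 1 phi (phi1 x).
  by rewrite in_itv/= => /andP[x0 xs]; apply: dphi'; rewrite in_itv/= !ltW.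
have cphi : {within `[0, s], continuous phi}.
  by apply: derivable_within_continuous => x /dphi' D; exact: (@ex_derive _ _ _ _ _ _ _ D).
have [y + E] := MVT s0 dphi'' cphi.
rewrite in_itv/= => /andP[y0 ys].
have : phi s <= phi 0 by apply: mx; rewrite gtr0_norm.
rewrite -subr_le0 E subr0 leNgt mulr_gt0//.
exact: pos y0 (lt_trans ys sr).
Qed.

Lemma is_derive_radial_line (R : realType) (g : R -> R) (g1 s0 D t : R) :
  is_derive (s0 + 2 * t * D + t ^+ 2) 1 g g1 ->
  is_derive t 1 (fun t => g (s0 + 2 * t * D + t ^+ 2)) ((2 * D + 2 * t) * g1).
Proof.
move=> dg.
have dq : is_derive t 1 (fun t : R => s0 + 2 * t * D + t ^+ 2) (2 * D + 2 * t).
  have E : (fun t : R => s0 + 2 * t * D + t ^+ 2) = cst s0 + (2 * D) \*: id + id * id.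
    by apply/funext => x; rewrite expr2 mulrAC.
  rewrite E; have d := is_deriveD (is_deriveD (is_derive_cst s0 t 1)
    (is_deriveZ (2 * D) (is_derive_id t 1))) (is_deriveM (is_derive_id t 1) (is_derive_id t 1)).
  apply: (is_derive_eq d); rewrite /GRing.scale/= add0r !mulr1 -mulr2n.
  by rewrite -[t *+ 2]mulr_natl.
have := @is_derive1_comp _ g (fun t : R => s0 + 2 * t * D + t ^+ 2) t _ _ dg dq.
by move=> H; apply: (is_derive_eq H); rewrite mulrC.
Qed.

(** At a point where [v] minus a radial profile has a local extremum, the first
    two derivatives of [v] along each axis compare with those of the profile,
    so the gradients agree and the Laplacians are ordered.  The profile
    covers both the quadratic penalization of the doubling argument and the
    barriers on balls.  A positive [sg] stands for a maximum and a
    negative one for a minimum. *)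
Lemma radial_touching (R : realType) (n : nat) (Om : set 'rV[R]_n)
    (v : 'rV[R]_n -> R) (x0 z : 'rV[R]_n) (g g1 : R -> R) (g2 sg : R) :
  open Om -> C2_on Om v -> Om x0 -> sg != 0 ->
  (\forall s \near sqn (x0 - z), is_derive (s : R) 1 g (g1 s)) ->
  is_derive (sqn (x0 - z)) 1 g1 g2 ->
  (\forall x \near x0,
     sg * (v x - g (sqn (x - z))) <= sg * (v x0 - g (sqn (x0 - z)))) ->
  grad v x0 = (2 * g1 (sqn (x0 - z))) *: (x0 - z) /\
  sg * laplacian v x0 <=
    sg * (4 * g2 * sqn (x0 - z) + 2 * n%:R * g1 (sqn (x0 - z))).
Proof.
move=> oOm [C1v C2v] Omx0 sg0 dg dg1 mx.
set s0 := sqn (x0 - z) in dg dg1 mx *.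
have key (i : 'I_n) : partial i v x0 = 2 * g1 s0 * (x0 - z) 0 i /\
    sg * partial i (partial i v) x0 <=
      sg * (4 * g2 * (x0 - z) 0 i ^+ 2 + 2 * g1 s0).
  set D := (x0 - z) 0 i.
  pose e : 'rV[R]_n := delta_mx 0 i.
  pose q (t : R) := s0 + 2 * t * D + t ^+ 2.
  have qE t : sqn (x0 + t *: e - z) = q t by rewrite addrAC sqn_line.
  have q0 : q 0 = s0 by rewrite /q mulr0 mul0r expr0n /= !addr0.
  have l0 : x0 + 0 *: e = x0 by rewrite scale0r addr0.
  have cl : (x0 + t *: e) @[t --> (0 : R)] --> x0.
    rewrite -[X in _ --> X]l0; apply: cvgD; first exact: cvg_cst.
    by apply: cvgZr_tmp; exact: cvg_id.
  have cq : q t @[t --> (0 : R)] --> s0.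
    rewrite -[X in _ --> X]q0; apply: cvgD; last exact: (@exprn_continuous _ 2).
    apply: cvgD; first exact: cvg_cst.
    by apply: cvgMr_tmp; apply: cvgMl_tmp; exact: cvg_id.
  have n1 : nbhs (0 : R) ((fun t => x0 + t *: e) @^-1` Om).
    exact: (cl _ (open_nbhs_nbhs (conj oOm Omx0))).
  have n2 : nbhs (0 : R) (q @^-1` [set s : R | is_derive s 1 g (g1 s)]) := cq _ dg.
  have n3 : nbhs (0 : R) ((fun t => x0 + t *: e) @^-1` [set x |
     sg * (v x - g (sqn (x - z))) <= sg * (v x0 - g s0)]) := cl _ mx.
  have F0 : Filter (nbhs (0 : R)) by exact: _.
  have [r r0 rP] := iffLR (nbhs_ballP _ _) (@filterI _ _ F0 _ _ n1 (@filterI _ _ F0 _ _ n2 n3)).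
  have rP' (t : R) : `|t| < r -> [/\ Om (x0 + t *: e),
      is_derive (q t) 1 g (g1 (q t)) &
      sg * (v (x0 + t *: e) - g (q t)) <= sg * (v x0 - g s0)].
    move=> tr; have [|Omt [dt]] := rP t; first by rewrite /ball/= sub0r normrN.
    by rewrite /= qE.
  have [|||] := @second_derivative_at_max R
    (fun t => sg * (v (x0 + t *: e) - g (q t)))
    (fun t => sg * (partial i v (x0 + t *: e) - (2 * D + 2 * t) * g1 (q t)))
    (sg * (partial i (partial i v) x0 - (4 * g2 * D ^+ 2 + 2 * g1 s0))) r r0.
  - move=> t /rP'[Omt dt _].
    have dv : is_derive t 1 (fun s => v (x0 + s *: e)) (partial i v (x0 + t *: e)).
      by apply: is_derive_line; apply: diff_derivable; case: (C1v _ Omt).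
    have dgq := is_derive_radial_line dt.
    have := @is_deriveZ _ _ _ _ sg _ _ _ (@is_deriveB _ _ _ _ _ _ _ _ _ dv dgq).
    by [].
  - have dv : is_derive (0:R) 1 (fun s => partial i v (x0 + s *: e)) (partial i (partial i v) x0).
      rewrite -{2}l0; apply: is_derive_line; apply: diff_derivable.
      by rewrite l0; case: (C2v i x0 Omx0).
    have dg1' : is_derive (q 0) 1 g1 g2 by rewrite q0.
    have dgq := is_derive_radial_line dg1'.
    have dl : is_derive (0:R) 1 (fun t : R => 2 * D + 2 * t) 2.
      rewrite (_ : (fun _ => _) = cst (2 * D) + 2 \*: id)//.
      by apply: is_derive_eq; rewrite /GRing.scale/= mulr1 add0r.
    have := @is_deriveZ _ _ _ _ sg _ _ _ (@is_deriveB _ _ _ _ _ _ _ _ _ dv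
       (@is_deriveM _ _ _ _ _ _ _ _ dl dgq)).
    move=> H; apply: (is_derive_eq H); rewrite /GRing.scale/=; congr (_ * (_ - _)).
    by rewrite -/(q 0) q0; ring.
  - by move=> t /rP'[_ _]; rewrite l0 q0.
  rewrite l0 q0 mulr0 addr0 => /eqP; rewrite mulf_eq0 (negbTE sg0)/= subr_eq0.
  by move=> /eqP -> ; rewrite mulrBr subr_le0 => ->; split=> //; ring.
split.
  by apply/rowP => i; rewrite !mxE; have [-> _] := key i; rewrite !mxE.
rewrite /laplacian mulr_sumr.
apply: le_trans (_ : \sum_(i < n) sg * (4 * g2 * (x0 - z) 0 i ^+ 2 + 2 * g1 s0) <= _).
  by apply: ler_sum => i _; case: (key i).
rewrite -mulr_sumr big_split/= -mulr_sumr sumr_const card_ord -/(sqn _) -/s0.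
by rewrite -[2 * g1 s0 *+ n]mulr_natr le_eqVlt; apply/orP; left; apply/eqP; ring.
Qed.

Lemma quadratic_touching (R : realType) (n : nat) (Om : set 'rV[R]_n)
    (v : 'rV[R]_n -> R) (x0 a : 'rV[R]_n) (k sg : R) :
  open Om -> C2_on Om v -> Om x0 -> sg != 0 ->
  (\forall x \near x0,
     sg * (v x - k * sqn (x - a)) <= sg * (v x0 - k * sqn (x0 - a))) ->
  grad v x0 = (2 * k) *: (x0 - a) /\
  sg * laplacian v x0 <= sg * (2 * n%:R * k).
Proof.
move=> oOm C2v Omx0 sg0 mx.
have dk (s : R) : is_derive s 1 (fun s => k * s) (cst k s).
  have := @is_deriveZ _ _ _ id k s 1 _ (is_derive_id _ _).
  by move=> H; apply: (is_derive_eq H); exact: mulr1.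
have nd : \forall s \near sqn (x0 - a), is_derive (s : R) 1 (fun s => k * s) (cst k s).
  by apply/nbhs_ballP; exists 1 => //= s _; exact: dk.
have := @radial_touching R n Om v x0 a (fun s => k * s) (cst k) 0 sg oOm C2v Omx0 sg0
  nd (is_derive_cst k (sqn (x0 - a)) 1) mx.
by rewrite mulr0 mul0r add0r.
Qed.

(** * Local Taylor estimates *)

Lemma sum_le_const (R : realType) (n : nat) (F : 'I_n -> R) (c : R) :
  (forall i, F i <= c) -> \sum_(i < n) F i <= n%:R * c.
Proof.
move=> Fc; rewrite mulr_natl -[X in _ *+ X](card_ord n) -sumr_const.
exact: ler_sum.
Qed.

Lemma derive_sum_partial (R : realType) (n : nat) (g : 'rV[R]_n -> R) (x v : 'rV[R]_n) :
  differentiable g x -> 'D_v g x = \sum_(i < n) v 0 i * partial i g x.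
Proof.
move=> dg; rewrite deriveE// {1}(row_sum_delta v) linear_sum.
by apply: eq_bigr => i _; rewrite linearZ /partial deriveE.
Qed.

Lemma mean_value_line (R : realType) (n : nat) (g : 'rV[R]_n -> R) (x v : 'rV[R]_n) (T : R) :
  0 < T -> (forall t, 0 <= t -> t <= T -> derivable g (x + t *: v) v) ->
  exists2 t, 0 <= t /\ t <= T & g (x + T *: v) - g x = 'D_v g (x + t *: v) * T.
Proof.
move=> T0 dg.
have dl (t : R) : t \in `[0, T]%R ->
    is_derive t 1 (fun s => g (x + s *: v)) ('D_v g (x + t *: v)).
  by rewrite in_itv/= => /andP[t0 tT]; apply: is_derive_line; exact: dg.
have dl' (t : R) : t \in `]0, T[%R ->
    is_derive t 1 (fun s => g (x + s *: v)) ('D_v g (x + t *: v)).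
  by rewrite in_itv/= => /andP[t0 tT]; apply: dl; rewrite in_itv/= !ltW.
have cl : {within `[0, T], continuous (fun s => g (x + s *: v))}.
  by apply: derivable_within_continuous => t /dl D; exact: (@ex_derive _ _ _ _ _ _ _ D).
have [t + E] := MVT T0 dl' cl.
rewrite in_itv/= => /andP[t0 tT]; exists t; first by rewrite !ltW.
by rewrite subr0 scale0r addr0 in E.
Qed.

Lemma mean_value (R : realType) (n : nat) (g : 'rV[R]_n -> R) (x w : 'rV[R]_n) :
  (forall t, 0 <= t -> t <= 1 -> differentiable g (x + t *: (w - x))) ->
  exists2 t, 0 <= t /\ t <= 1 &
    g w - g x = \sum_(i < n) (w - x) 0 i * partial i g (x + t *: (w - x)).
Proof.
move=> dg.
have [|t [t0 t1]] := @mean_value_line R n g x (w - x) 1 ltr01.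
  by move=> t t0 t1; apply: diff_derivable; exact: dg.
rewrite scale1r [x + (w - x)]addrC subrK mulr1 => E; exists t => //.
by rewrite E derive_sum_partial//; exact: dg.
Qed.

Lemma segment_ball (R : realType) (n : nat) (b x w : 'rV[R]_n) (rho t : R) :
  0 <= t -> t <= 1 -> `|x - b| < rho -> `|w - b| < rho ->
  `|x + t *: (w - x) - b| < rho.
Proof.
move=> t0 t1 xb wb.
have -> : x + t *: (w - x) - b = (1 - t) *: (x - b) + t *: (w - b).
  by apply/rowP => i; rewrite !mxE; ring.
apply: le_lt_trans (ler_normD _ _) _; rewrite !normrZ !ger0_norm ?subr_ge0//.
have [->|tn0] := eqVneq t 0; first by rewrite subr0 mul1r mul0r addr0.
have tp : 0 < t by rewrite lt_neqAle eq_sym tn0.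
by nra.
Qed.

(** Two applications of the mean value theorem; the second derivatives are
    bounded near [b] by continuity, which makes the remainder uniform in the base
    point [x].  The points [x] and [w] must stay in a ball, for convexity. *)
Lemma taylor_quadratic (R : realType) (n : nat) (g : 'rV[R]_n -> R) (b : 'rV[R]_n) :
  C2_on setT g -> exists2 M : R, 0 < M & exists2 rho : R, 0 < rho &
    (forall x i, `|x - b| < rho -> `|partial i g x| <= M) /\
    (forall x w, `|x - b| < rho -> `|w - b| < rho ->
      `|g w - g x - \sum_(i < n) (w - x) 0 i * partial i g x| <= M * sqn (w - x)).
Proof.
move=> [C1g C2g].
have loc (h : 'rV[R]_n -> R) : {for b, continuous h} ->
    \forall x \near b, `|h x| <= `|h b| + 1.
  move=> ch; have l : `|h b| < `|h b| + 1 by rewrite ltrDl.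
  near=> x; apply: ltW; near: x; exact: (cvgr_norm_lt (h b) ch _ l).
have n1 : \forall x \near b, forall i, `|partial i g x| <= `|partial i g b| + 1.
  by apply: (@filter_forall _ _ _ (nbhs b)) => i; apply: loc; case: (C1g b I).
have n2 : \forall x \near b, forall ij : 'I_n * 'I_n,
    `|partial ij.1 (partial ij.2 g) x| <= `|partial ij.1 (partial ij.2 g) b| + 1.
  by apply: (@filter_forall _ _ _ (nbhs b)) => -[i j]; apply: loc; case: (C2g j b I).
have [rho rho0 rhoP] := iffLR (nbhs_ballP _ _) (filterI n1 n2).
pose M1 := \sum_(i < n) `|partial i g b| + 1.
pose M2 := \sum_(ij : 'I_n * 'I_n) `|partial ij.1 (partial ij.2 g) b| + 1.
have M1_0 : 0 < M1 by rewrite ltr_wpDl// sumr_ge0.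
have M2_0 : 0 < M2 by rewrite ltr_wpDl// sumr_ge0.
have M1P i x : `|x - b| < rho -> `|partial i g x| <= M1.
  move=> xb; have [|/(_ i) H _] := rhoP x; first by rewrite -ball_normE/= distrC.
  apply: le_trans H _; rewrite lerD2r (bigD1 i)//= lerDl; exact: sumr_ge0.
have M2P i j x : `|x - b| < rho -> `|partial i (partial j g) x| <= M2.
  move=> xb; have [|_ /(_ (i, j)) H] := rhoP x; first by rewrite -ball_normE/= distrC.
  apply: le_trans H _; rewrite lerD2r (bigD1 (i, j))//= lerDl; exact: sumr_ge0.
have N0 : 0 <= n%:R * (n%:R * M2) by rewrite !mulr_ge0// ltW.
exists (M1 + n%:R * (n%:R * M2)); first by rewrite ltr_wpDr.
exists rho => //; split=> [x i /M1P /le_trans -> //|x w xb wb].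
  by rewrite lerDl.
have [|t [t0 t1] ->] := @mean_value R n g x w.
  by move=> t _ _; case: (C1g (x + t *: (w - x)) I).
rewrite -sumrB; under eq_bigr do rewrite -mulrBr.
apply: le_trans (ler_norm_sum _ _ _) _.
apply: le_trans (_ : n%:R * (n%:R * M2) * sqn (w - x) <= _); last first.
  by rewrite ler_wpM2r ?sqn_ge0// lerDr ltW.
rewrite -mulrA; apply: sum_le_const => i; set y := x + t *: (w - x).
have yb : `|y - b| < rho by exact: segment_ball.
have [|s [s0 s1] ->] := @mean_value R n (partial i g) x y.
  by move=> s _ _; case: (C2g i (x + s *: (y - x)) I).
rewrite mulr_sumr; apply: le_trans (ler_norm_sum _ _ _) _.
rewrite -mulrA; apply: sum_le_const => j; set z := x + s *: (y - x).
have zb : `|z - b| < rho by exact: segment_ball.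
have -> : (y - x) 0 j = t * (w - x) 0 j by rewrite /y addrAC subrr add0r mxE.
rewrite !normrM (ger0_norm t0).
rewrite -enorm_sqr expr2.
apply: (@le_trans _ _ (enorm (w - x) * (enorm (w - x) * M2))); last by rewrite mulrA mulrC.
apply: ler_pM; rewrite ?mulr_ge0//; first exact: coord_le_enorm.
apply: ler_pM; rewrite ?mulr_ge0//; last exact: M2P.
by rewrite -[leRHS]mul1r ler_pM// coord_le_enorm.
Unshelve. all: by end_near. Qed.

(** * Interior balls near a C^2 boundary *)

Definition dot (R : realType) (n : nat) (u v : 'rV[R]_n) : R :=
  \sum_(i < n) u 0 i * v 0 i.

Lemma sqn_subZ (R : realType) (n : nat) (v u : 'rV[R]_n) (t : R) :
  sqn (v - t *: u) = sqn v - 2 * t * dot v u + t ^+ 2 * sqn u.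
Proof.
rewrite /sqn /dot !mulr_sumr -sumrB -big_split/=; apply: eq_bigr => i _.
by rewrite !mxE; ring.
Qed.

Lemma sum_col' (R : realType) (n : nat) (k : 'I_n) (F : 'I_n -> R) :
  \sum_(i < n) F i = F k + \sum_(j < n.-1) F (lift k j).
Proof. by rewrite (bigD1_ord k). Qed.

Lemma sqn_col' (R : realType) (n : nat) (k : 'I_n) (v : 'rV[R]_n) :
  sqn v = v 0 k ^+ 2 + sqn (col' k v).
Proof.
by rewrite /sqn (sum_col' k); congr (_ + _); apply: eq_bigr => j _; rewrite mxE.
Qed.

Lemma norm_col'_le (R : realType) (n : nat) (k : 'I_n) (v : 'rV[R]_n) :
  `|col' k v| <= `|v|.
Proof. by apply: mx_norm_le => // j; rewrite mxE coord_le_norm. Qed.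

Lemma enorm_col'_le (R : realType) (n : nat) (k : 'I_n) (v : 'rV[R]_n) :
  enorm (col' k v) <= enorm v.
Proof.
by rewrite enorm_le ?enorm_ge0// enorm_sqr (sqn_col' k v) lerDr sqr_ge0.
Qed.

(** A ball on which a barrier can be placed when [x] is close to the complement
    of [Om].  The depth of [x] in the ball is measured by a number [h] that
    dominates both [d x], up to the factor [c], and the distance from [x] to the
    complement; in a graph chart the height of [x] above the graph is such a
    number. *)
Definition deep_ball (R : realType) (n : nat) (Om : set 'rV[R]_n)
    (d : 'rV[R]_n -> R) (c : R) (x : 'rV[R]_n) : Prop :=
  forall (r : R) (y : 'rV[R]_n), 0 < r -> r <= c -> ~ Om y -> enorm (x - y) <= c * r ->
  exists (z : 'rV[R]_n) (h : R),
    [/\ 0 < h, forall w, enorm (w - z) <= r -> Om w,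
        enorm (x - z) <= r - c * h, c * d x <= h &
        exists2 y0, ~ Om y0 & enorm (x - y0) <= h].

(** A ball of centre [t *: nu] through the origin satisfies the quadratic
    inequality [|v|^2 <= 2 * t * dot v nu], so it lies above a paraboloid. *)
Lemma ball_in_paraboloid (R : realType) (n : nat) (v nu : 'rV[R]_n) (t M : R) :
  0 < t -> 2 * t * M <= 1 -> sqn (v - t *: nu) <= t ^+ 2 * sqn nu ->
  M * sqn v <= dot v nu.
Proof.
move=> t0 tM; rewrite sqn_subZ => H.
have H1 : sqn v <= 2 * t * dot v nu by lra.
have H2 : 2 * t * M * sqn v <= 1 * sqn v by rewrite ler_wpM2r ?sqn_ge0.
have : 2 * t * (M * sqn v) <= 2 * t * dot v nu by lra.
by rewrite ler_pM2l// mulr_gt0.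
Qed.

Lemma tangent_ball_depth (R : realType) (h t r c : R) :
  0 < h -> h <= t -> r * c <= t / 4 ->
  h ^+ 2 / 4 - t * h + r ^+ 2 <= (r - c * h) ^+ 2.
Proof.
move=> h0 ht rc.
have hh : h * h <= h * t by rewrite ler_pM2l.
have rch : r * c * h <= t / 4 * h by rewrite ler_pM2r.
have th0 : 0 < t * h by rewrite mulr_gt0//; exact: lt_le_trans h0 ht.
have := sqr_ge0 (c * h); lra.
Qed.

(** The height of [x] above the graph serves as the depth [h].  Let [m] be the
    point [h / 2] below [x] along the axis.  The gradient of [gamma] gives a normal
    direction [nu] at [m], and a ball through [m] with centre [m + t *: nu] lies
    above a paraboloid of opening [1 / (2 * t)] through [m].  By the Taylor
    estimate this paraboloid lies above the graph once [t <= 1 / (2 * M)].  As [x]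
    is [h / 2] above [m], its depth in the ball is comparable to [h]. *)
Lemma epigraph_deep_ball (R : realType) (n : nat) (Om : set 'rV[R]_n)
    (d : 'rV[R]_n -> R) (b0 : 'rV[R]_n) (k : 'I_n) (S : R)
    (gamma : 'rV[R]_(n.-1) -> R) (rho M Md : R) :
  S ^+ 2 = 1 -> 0 < rho -> 0 < M -> 0 < Md ->
  (forall x : 'rV[R]_n, `|x - b0| < rho -> (Om x <-> gamma (col' k x) < S * x 0 k)) ->
  (forall (x : 'rV[R]_(n.-1)) i, `|x - col' k b0| < rho -> `|partial i gamma x| <= M) ->
  (forall x w : 'rV[R]_(n.-1), `|x - col' k b0| < rho -> `|w - col' k b0| < rho ->
     `|gamma w - gamma x - \sum_(i < n.-1) (w - x) 0 i * partial i gamma x|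
       <= M * sqn (w - x)) ->
  (forall x : 'rV[R]_n, differentiable d x) ->
  (forall (x : 'rV[R]_n) i, `|x - b0| < rho -> `|partial i d x| <= Md) ->
  (forall x, ~ Om x -> d x <= 0) ->
  exists2 c : R, 0 < c & forall x : 'rV[R]_n, `|x - b0| < c -> Om x -> deep_ball Om d c x.
Proof.
move=> S2 rho0 M0 Md0 chart Mgrad Mquad dd Mdd dneg.
(* [N] bounds the length of the normal vector [nu], and [La] is a Lipschitz
   constant for the height above the graph. *)
have nR : 1 <= n%:R :> R by rewrite ler1n; case: n k {chart Mgrad Mquad d b0 gamma Om dd Mdd dneg} => [[]|].
set N := 1 + n%:R * M.
set La := 1 + n%:R * M + M.
have N1 : 1 <= N by rewrite /N; nra.
have La1 : 1 <= La by rewrite /La; nra.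
set A := 4 * (La * N + M + n%:R * Md).
have A4 : 4 <= A by rewrite /A; nra.
pose c := Num.min A^-1 (rho / 5).
have A0 : 0 < A by lra.
have c0 : 0 < c by rewrite lt_min invr_gt0 A0 divr_gt0.
have cA : c * A <= 1.
  by rewrite -ler_pdivlMr// mul1r ge_min lexx.
have crho : 5 * c <= rho.
  have : c <= rho / 5 by rewrite ge_min lexx orbT.
  lra.
have cLN : c * (4 * (La * N)) <= 1.
  apply: le_trans cA; rewrite ler_pM2l// /A; nra.
have cM : c * (4 * M) <= 1.
  apply: le_trans cA; rewrite ler_pM2l// /A; nra.
have cMd : c * (n%:R * Md) <= 1.
  apply: le_trans cA; rewrite ler_pM2l// /A; nra.
have cN : c * (4 * N) <= 1.
  apply: le_trans cLN; rewrite ler_pM2l//; nra.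
have c1 : c <= 1 by nra.
exists c => // x xb Omx r y r0 rc nOmy xy.
pose g (w : 'rV[R]_n) := S * w 0 k - gamma (col' k w).
have chart' (w : 'rV[R]_n) : `|w - b0| < rho -> (Om w <-> 0 < g w).
  by move=> /chart ->; rewrite /g subr_gt0.
have near_col (w : 'rV[R]_n) : `|w - b0| < rho -> `|col' k w - col' k b0| < rho.
  by move=> wb; rewrite -linearB; exact: le_lt_trans (norm_col'_le _ _) wb.
have xrho : `|x - b0| < rho by apply: lt_le_trans xb _; lra.
set e := enorm (x - y) in xy.
have e0 : 0 <= e by exact: enorm_ge0.
have yx : enorm (y - x) = e by rewrite enormB.
have cr_c : c * r <= c by nra.
have e1 : e <= 1 by lra.
have yrho : `|y - b0| < rho.
  rewrite -(subrK x y) -addrA; apply: le_lt_trans (ler_normD _ _) _.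
  have := norm_le_enorm (x - y); rewrite distrC -/e => H.
  by lra.
set h := g x.
have h0 : 0 < h by apply/chart'.
pose q : 'rV[R]_(n.-1) := \row_j partial j gamma (col' k x).
have qM j : `|q 0 j| <= M by rewrite mxE; apply: Mgrad; exact: near_col.
have n1n : (n.-1)%:R <= n%:R :> R by rewrite ler_nat leq_pred.
have hLa : h <= La * e.
  have gy : g y <= 0 by rewrite leNgt; apply/negP => /(chart' _ yrho).
  have := Mquad (col' k x) (col' k y) (near_col _ xrho) (near_col _ yrho).
  rewrite -linearB.
  have s1 : sqn (col' k (y - x)) <= e.
    rewrite -enorm_sqr.
    have := enorm_col'_le k (y - x); have := enorm_ge0 (col' k (y - x)).
    rewrite yx => H1 H2; nra.
  have s2 : \sum_(i < n.-1) (col' k (y - x)) 0 i * partial i gamma (col' k x)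
      <= n%:R * (e * M).
    apply: le_trans (_ : n.-1%:R * (e * M) <= _); last first.
      by rewrite ler_wpM2r// mulr_ge0// ltW.
    apply: sum_le_const => i; apply: le_trans (ler_norm _) _; rewrite normrM.
    apply: ler_pM => //; last by have := qM i; rewrite mxE.
    apply: le_trans (coord_le_enorm _ _) _; apply: le_trans (enorm_col'_le _ _) _.
    by rewrite yx.
  have s3 : S * (x - y) 0 k <= e.
    apply: le_trans (ler_norm _) _; rewrite normrM.
    have -> : `|S| = 1 by apply/eqP; rewrite -sqr_norm_eq1 S2.
    by rewrite mul1r; exact: coord_le_enorm.
  rewrite ler_norml => /andP[_ s4].
  rewrite !mxE in s3; rewrite /h /g in gy *; rewrite /La; nra.
have hN : N * h <= r.
  have : N * h <= N * (La * (c * r)).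
    by rewrite ler_pM2l; [nra|lra].
  nra.
pose ek : 'rV[R]_n := delta_mx 0 k.
have colek : col' k ek = 0.
  by apply/rowP => j; rewrite !mxE eqxx [lift k j == k]eq_sym (negbTE (neq_lift k j)).
have colx (a : R) : col' k (x - a *: ek) = col' k x.
  apply/rowP => j; have := congr1 (fun u : 'rV[R]_(n.-1) => u 0 j) colek.
  by rewrite !mxE => ->; rewrite mulr0 subr0.
have ekk : ek 0 k = 1 by rewrite mxE !eqxx.
have dotek v : dot ek v = v 0 k.
  rewrite /dot (sum_col' k) ekk mul1r big1 ?addr0// => j _.
  have := congr1 (fun u : 'rV[R]_(n.-1) => u 0 j) colek.
  by rewrite !mxE => ->; rewrite mul0r.
have sqnek (a : R) : sqn (a *: ek) = a ^+ 2.
  by have := sqn_line 0 k a; rewrite add0r sqn0 mxE mulr0 !add0r.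
(* [y0] is the point of the graph below [x]. *)
pose y0 := x - (S * h) *: ek.
have xy0 : enorm (x - y0) = h.
  rewrite /y0 opprB addrC subrK /enorm -/(sqn _) sqnek exprMn S2 mul1r.
  by rewrite sqrtr_sqr gtr0_norm.
have y0rho : `|y0 - b0| < rho.
  rewrite -(subrK x y0) -addrA; apply: le_lt_trans (ler_normD _ _) _.
  have := norm_le_enorm (x - y0); rewrite distrC xy0 => H; nra.
have nOmy0 : ~ Om y0.
  move/(chart' _ y0rho); rewrite /g /y0 colx.
  rewrite !mxE !eqxx mulr1 mulrBr mulrA -expr2 S2 mul1r.
  have hE : h = S * x 0 k - gamma (col' k x) by [].
  by move=> H; lra.
have dh : d x <= n%:R * (h * Md).
  have [|t [t0 t1] E] := @mean_value R n d y0 x; first by move=> *; exact: dd.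
  have := dneg _ nOmy0.
  rewrite -[d x](subrK (d y0)) => dy0; apply: (le_trans (lerD _ dy0)); last first.
    by rewrite addr0.
  rewrite E; apply: sum_le_const => i; apply: le_trans (ler_norm _) _.
  rewrite normrM; apply: ler_pM => //; first by rewrite -xy0 coord_le_enorm.
  by apply: Mdd; exact: segment_ball.
(* [nu] is the upward normal of the graph at the point below [x], scaled so
   that its [k]-th coordinate is a unit. *)
pose nu : 'rV[R]_n := \row_i (if unlift k i is Some j then - q 0 j else S).
have nuk : nu 0 k = S by rewrite mxE unlift_none.
have colnu : col' k nu = - q by apply/rowP => j; rewrite !mxE liftK mxE.
have sqnnu : sqn nu = 1 + sqn q by rewrite (sqn_col' k) nuk S2 colnu sqnN.
have sqnq : sqn q <= n%:R * M ^+ 2.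
  apply: le_trans (_ : n.-1%:R * M ^+ 2 <= _); last by rewrite ler_wpM2r// sqr_ge0.
  apply: sum_le_const => j; rewrite -[leLHS]real_normK ?num_real//.
  by rewrite lerXn2r ?nnegrE// ltW.
set nn := enorm nu.
have nn2 : nn ^+ 2 = 1 + sqn q by rewrite enorm_sqr.
have nn0 : 0 <= nn by exact: enorm_ge0.
have nn1 : 1 <= nn.
  by rewrite -(ler_pXn2r (n := 2)) ?nnegrE// expr1n nn2 lerDl sqn_ge0.
have nnN : nn <= N.
  by rewrite enorm_le; [rewrite sqnnu /N; nra|lra].
pose t := r / nn.
have tnn : t * nn = r by rewrite divfK// gt_eqF// (lt_le_trans ltr01 nn1).
have nn0' : 0 < nn by exact: lt_le_trans ltr01 nn1.
have t0 : 0 < t by rewrite divr_gt0.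
have tr : t <= r by rewrite -tnn ler_peMr// ltW.
have ht : h <= t.
  by rewrite ler_pdivlMr//; apply: le_trans hN; rewrite mulrC ler_pM2r.
clearbody t.
have t2M : 2 * t * M <= 1.
  apply: le_trans cM; apply: (@le_trans _ _ (c * (2 * M))).
    by rewrite [2 * t]mulrC -mulrA ler_pM2r ?mulr_gt0// (le_trans tr rc).
  by rewrite ler_pM2l// ler_pM2r// ler_nat.
have rt : r <= N * t by rewrite -tnn mulrC ler_pM2r.
pose m := x - (S * h / 2) *: ek.
pose z := m + t *: nu.
have xz : sqn (x - z) = h ^+ 2 / 4 - t * h + r ^+ 2.
  have -> : x - z = (S * h / 2) *: ek - t *: nu.
    by rewrite /z /m; apply/rowP => i; rewrite !mxE; ring.
  rewrite sqn_subZ sqnek /dot; under eq_bigr do rewrite mxE -mulrA.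
  rewrite -mulr_sumr -/(dot _ _) dotek nuk sqnnu -nn2 -tnn.
  transitivity (S ^+ 2 * h ^+ 2 / 4 - t * h * S ^+ 2 + (t * nn) ^+ 2); first by field.
  by rewrite S2; field.
exists z, h; split => //.
- move=> w wz.
  have wrho : `|w - b0| < rho.
    have -> : w - b0 = (w - z) + (z - x) + (x - b0) by rewrite subrKA subrKA.
    apply: le_lt_trans (ler_normD _ _) _.
    have H1 := ler_normD (w - z) (z - x).
    have H2 := le_trans (norm_le_enorm _) wz.
    have H3 : `|z - x| <= r.
      apply: le_trans (norm_le_enorm _) _; rewrite enormB enorm_le ?(ltW r0)// xz.
      have H4 : h * h <= t * h by rewrite ler_pM2r.
      have H5 : 0 < h * h by rewrite mulr_gt0.
      by move: H4 H5; clear; lra.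
    by move: H1 H2 H3 xb rc c0 crho; clear; lra.
  apply/(chart' _ wrho).
  set v := w - m.
  have dv : M * sqn v <= dot v nu.
    apply: (ball_in_paraboloid t0 t2M).
    rewrite /v -addrA -opprD -/z sqnnu -nn2 -exprMn tnn.
    by rewrite -enorm_le// ltW.
  have wE : w = m + v by rewrite /v addrC subrK.
  have colm : col' k m = col' k x by exact: colx.
  have := Mquad (col' k x) (col' k w) (near_col _ xrho) (near_col _ wrho).
  have -> : col' k w - col' k x = col' k v by rewrite -colm -linearB.
  have dotE : dot v nu = S * v 0 k - \sum_(i < n.-1) (col' k v) 0 i * partial i gamma (col' k x).
    rewrite /dot (sum_col' k) nuk mulrC -sumrN; congr (_ + _).
    apply: eq_bigr => j _; have := congr1 (fun u : 'rV[R]_(n.-1) => u 0 j) colnu.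
    by rewrite !mxE => ->; rewrite mulrN.
  have sv : sqn (col' k v) <= sqn v by rewrite (sqn_col' k v) lerDr sqr_ge0.
  have gw : g w = S * x 0 k - h / 2 + S * v 0 k - gamma (col' k w).
    have wk : w 0 k = m 0 k + v 0 k by rewrite {1}wE mxE.
    have mk : m 0 k = x 0 k - S * h / 2 by rewrite !mxE !eqxx mulr1.
    rewrite /g wk mk.
    have -> : S * (x 0 k - S * h / 2 + v 0 k) = S * x 0 k - S ^+ 2 * h / 2 + S * v 0 k by ring.
    by rewrite S2 mul1r.
  have hE : h = S * x 0 k - gamma (col' k x) by [].
  rewrite ler_norml => /andP[_ Q].
  have sv' : M * sqn (col' k v) <= M * sqn v by rewrite ler_pM2l.
  rewrite gw; lra.
- have rc4 : r * c <= t / 4.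
    have H1 : c * r <= c * (N * t) by rewrite ler_pM2l.
    have H2 : c * (4 * N) * t <= 1 * t by rewrite ler_pM2r.
    lra.
  have ch : c * h <= r.
    apply: le_trans (le_trans ht tr); rewrite -[leRHS]mul1r ler_pM2r//.
  rewrite enorm_le ?xz ?subr_ge0//; exact: tangent_ball_depth.
- apply: le_trans (_ : c * (n%:R * (h * Md)) <= _); first by rewrite ler_pM2l.
  have -> : c * (n%:R * (h * Md)) = c * (n%:R * Md) * h by ring.
  by rewrite -[leRHS]mul1r ler_pM2r.
- by exists y0; rewrite ?xy0.
Qed.

Lemma closure_sub_closed (T : topologicalType) (A B : set T) :
  closed B -> A `<=` B -> closure A `<=` B.
Proof. by move=> cB AB; rewrite [B in _ `<=` B](closure_id B).1//; exact: closureS. Qed.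

Lemma compact_closure_bounded (R : realType) (n : nat) (Om : set 'rV[R]_n) :
  bounded_set Om -> compact (closure Om).
Proof.
move=> [M [Mr MP]]; apply: bounded_closed_compact; last exact: closed_closure.
exists M; split => // N MN x; apply: closure_sub_closed x => [|x]; last exact: MP.
apply: (@closed_comp _ _ (fun x : 'rV[R]_n => `|x|) [set s | s <= N]).
  by move=> x _; exact: norm_continuous.
exact: closed_le.
Qed.

Lemma deep_ball_decr (R : realType) (n : nat) (Om : set 'rV[R]_n)
    (d : 'rV[R]_n -> R) (c c' : R) (x : 'rV[R]_n) :
  0 < c' -> c' <= c -> 0 <= d x -> deep_ball Om d c x -> deep_ball Om d c' x.
Proof.
move=> c'0 c'c dx D r y r0 rc' nOmy xy.
have [||z [h [h0 zB xz dh y0]]] := D r y r0 _ nOmy.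
- exact: le_trans rc' c'c.
- by apply: le_trans xy _; rewrite ler_pM2r.
exists z, h; split => //; nra.
Qed.

(** Finitely many boundary charts cover the closure of a bounded domain, so the
    constant can be taken the same for all points. *)
Lemma uniform_deep_ball (R : realType) (n : nat) (Om : set 'rV[R]_n)
    (d : 'rV[R]_n -> R) :
  open Om -> bounded_set Om -> C2_boundary Om -> C2_on setT d ->
  (forall x, Om x -> 0 < d x) -> (forall x, ~ Om x -> d x <= 0) ->
  exists2 c : R, 0 < c /\ c <= 1 & forall x, Om x -> deep_ball Om d c x.
Proof.
move=> oOm bOm bdry C2d dpos dneg.
have cK := compact_closure_bounded bOm.
have loc (b0 : 'rV[R]_n) : closure Om b0 ->
    exists2 c : R, 0 < c & forall x : 'rV[R]_n, `|x - b0| < c -> Om x -> deep_ball Om d c x.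
  move=> clb; have [Omb|nOmb] := pselect (Om b0).
    have [e /= e0 eP] := iffLR (nbhs_ballP _ _) (open_nbhs_nbhs (conj oOm Omb)).
    pose c := Num.min 1 (e / 2).
    have c1 : c <= 1 by rewrite ge_min lexx.
    have ce : c <= e / 2 by rewrite ge_min lexx orbT.
    exists c; first by rewrite lt_min ltr01 divr_gt0.
    move=> x xb Omx r y r0 rc nOmy xy; exfalso; apply: nOmy; apply: eP.
    rewrite -ball_normE/=.
    have -> : b0 - y = (b0 - x) + (x - y) by rewrite subrKA.
    apply: le_lt_trans (ler_normD _ _) _; rewrite distrC.
    have := norm_le_enorm (x - y); nra.
  have bb : boundary Om b0 by split=> // /interior_subset.
  have [r0 [r00 [k [s [gamma [C2g chart]]]]]] := bdry _ bb.
  have [M M0 [rho1 rho10 [Mgrad Mquad]]] := taylor_quadratic (col' k b0) C2g.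
  have [Md Md0 [rho2 rho20 [Mdd _]]] := taylor_quadratic b0 C2d.
  have n1 : 0 < n%:R + 1 :> R by rewrite ltr_wpDl.
  pose rho := Num.min (Num.min rho1 rho2) (r0 / (n%:R + 1)).
  have rho0 : 0 < rho by rewrite !lt_min rho10 rho20 divr_gt0.
  have l1 : rho <= rho1 by rewrite !ge_min lexx.
  have l2 : rho <= rho2 by rewrite !ge_min lexx orbT.
  have l3 : rho <= r0 / (n%:R + 1) by rewrite ge_min lexx orbT.
  apply: (@epigraph_deep_ball R n Om d b0 k ((-1) ^+ s) gamma rho M Md) => //.
  - by rewrite sqrr_sign.
  - move=> x xb; apply: chart; apply: le_lt_trans (enorm_le_norm _) _.
    by rewrite mulrC -ltr_pdivlMr//; exact: lt_le_trans xb l3.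
  - by move=> x i xb; apply: Mgrad; exact: lt_le_trans xb l1.
  - by move=> x w xb wb; apply: Mquad; [exact: lt_le_trans xb l1|exact: lt_le_trans wb l1].
  - by move=> x; case: C2d => /(_ x I)[].
  - by move=> x i xb; apply: Mdd; exact: lt_le_trans xb l2.
have nc := iffLR (compact_near_coveringP _) cK R (0 : R)^'+
  (fun c x => Om x -> deep_ball Om d c x) _.
have [|e /= e0 eP] := nc.
  move=> b0 /loc[c c0 cP].
  exists ([set x : 'rV[R]_n | `|x - b0| < c], [set c' : R | 0 < c' /\ c' < c]) => /=.
    split.
      apply/nbhs_ballP; exists c => //= x; rewrite -ball_normE/= distrC; exact.
    exists c => //= t; rewrite /ball_/= sub0r normrN => tc t0; split=> //.
    exact: le_lt_trans (ler_norm _) tc.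
  move=> [x c'] /= [xb [c'0 c'c]] Omx.
  by apply: (deep_ball_decr c'0 (ltW c'c)); [exact/ltW/dpos|exact: cP].
pose c := Num.min 1 (e / 2).
have c0 : 0 < c by rewrite lt_min ltr01 divr_gt0.
have ce : c <= e / 2 by rewrite ge_min lexx orbT.
exists c; first by rewrite c0 ge_min lexx.
move=> x Omx; apply: (eP c) => //=.
- rewrite /ball_/= sub0r normrN gtr0_norm//; lra.
- exact: subset_closure.
Qed.

(** The supremum of the parameters at which the segment from [x] to [y] is in
    [Om] gives a point of the closure that is not in the open set [Om]. *)
Lemma boundary_point_between (R : realType) (n : nat) (Om : set 'rV[R]_n)
    (x y : 'rV[R]_n) :
  open Om -> Om x -> ~ Om y ->
  exists2 b, boundary Om b & enorm (x - b) <= enorm (x - y).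
Proof.
move=> oOm Omx nOmy.
pose l (t : R) := x + t *: (y - x).
pose T := [set t : R | 0 <= t /\ t <= 1 /\ Om (l t)].
have l0 : l 0 = x by rewrite /l scale0r addr0.
have T0 : T 0 by split => //; split => //; rewrite l0.
have hT : has_sup T by split; [exists 0|exists 1 => t [_ []]].
pose t := sup T.
have t0 : 0 <= t by apply: ub_le_sup => //; case: hT.
have t1 : t <= 1 by apply: ge_sup => [|u [_ []]]; first by exists 0.
have cl : continuous l.
  move=> s; apply: cvgD; first exact: cvg_cst.
  by apply: cvgZr_tmp; exact: cvg_id.
exists (l t); last first.
  have -> : x - l t = t *: (x - y).
    by rewrite /l; apply/rowP => i; rewrite !mxE; ring.
  rewrite enormZ//; have := enorm_ge0 (x - y); nra.
split.
  move=> U /(cl t)/nbhs_ballP[e /= e0 eU].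
  have [s Ts st] := sup_adherent e0 hT.
  exists (l s); split; first by case: Ts => _ [].
  apply: eU; rewrite /ball/= ger0_norm ?subr_ge0; last by apply: ub_le_sup => //; case: hT.
  by rewrite ltrBlDr -ltrBlDl.
move=> /interior_subset Omt.
have [e /= e0 eP] := iffLR (nbhs_ballP _ _) (cl t _ (open_nbhs_nbhs (conj oOm Omt))).
have tlt1 : t < 1.
  rewrite lt_neqAle t1 andbT; apply/eqP => tE; apply: nOmy.
  by move: Omt; rewrite tE /l scale1r [x + _]addrC subrK.
pose s := Num.min (t + e / 2) 1.
have ts : t < s by rewrite lt_min tlt1 ltrDl divr_gt0.
have s1 : s <= 1 by rewrite ge_min lexx orbT.
have se : s <= t + e / 2 by rewrite ge_min lexx.
have : T s.
  split; first by apply: ltW; exact: le_lt_trans t0 ts.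
  split => //; apply: eP; rewrite /ball/= distrC gtr0_norm ?subr_gt0//; lra.
move=> Ts; have : s <= t by apply: ub_le_sup => //; case: hT.
by rewrite leNgt ts.
Qed.

(** * The boundary-layer barrier on a ball *)

Lemma sqn_sub_continuous (R : realType) (n : nat) (z : 'rV[R]_n) :
  continuous (fun w : 'rV[R]_n => sqn (w - z)).
Proof.
move=> x; apply: (@continuous_comp _ _ _ (fun w : 'rV[R]_n => w - z) (@sqn R n)).
  by apply: continuousB; [exact: cvg_id|exact: cst_continuous].
exact: sqn_continuous.
Qed.

Lemma compact_sqn_ball (R : realType) (n : nat) (z : 'rV[R]_n) (s : R) :
  compact [set w | sqn (w - z) <= s].
Proof.
apply: bounded_closed_compact.
  exists (`|z| + (s + 1)); split; first exact: num_real.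
  move=> N NM w /= ws; apply: le_trans (ltW NM).
  rewrite -[w](subrK z) addrC; apply: le_trans (ler_normD _ _) _; rewrite lerD2l.
  apply: le_trans (norm_le_enorm _) _.
  have := sqn_ge0 (w - z) => s0; have s1 : 0 <= s by exact: le_trans s0 ws.
  rewrite enorm_le; last lra.
  apply: le_trans ws _; nra.
apply: (@closed_comp _ _ (fun w : 'rV[R]_n => sqn (w - z)) [set t | t <= s]).
  by move=> x _; exact: sqn_sub_continuous.
exact: closed_le.
Qed.

Lemma C2_continuous (R : realType) (n : nat) (Om : set 'rV[R]_n) (v : 'rV[R]_n -> R)
    (x : 'rV[R]_n) : C2_on Om v -> Om x -> {for x, continuous v}.
Proof.
by move=> [C1v _] Omx; apply: differentiable_continuous; case: (C1v x Omx).
Qed.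

Lemma is_derive_profile (R : realType) (a Rs b s : R) : s < Rs ->
  is_derive s 1 (fun s => a * (Rs - s) `^ (- b)) (a * b * (Rs - s) `^ (- b - 1)).
Proof.
move=> sR.
have d1 : is_derive s 1 (fun s : R => Rs - s) (- 1).
  rewrite (_ : (fun _ => _) = cst Rs - id)//.
  by apply: is_derive_eq; rewrite sub0r.
have T0 : 0 < Rs - s by rewrite subr_gt0.
have d2 := is_derive1_powR (- b) T0.
have d3 := is_deriveZ a (@is_derive1_comp _ (fun t => t `^ (- b)) (fun s => Rs - s) s _ _ d2 d1).
by apply: (is_derive_eq d3); rewrite /GRing.scale/=; ring.
Qed.

(** The exponent [b] with [b * p = b + 1]: if a profile has derivative [T^(-b)],
    with [T] a distance to the place of blow-up, then the [p]-th power of its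
    gradient and its second derivative blow up at the same rate. *)
Definition layer_exponent (R : realType) (p : R) : R := (p - 1)^-1.

(** On a ball of radius [r] the Laplacian of a radial profile with derivative
    [a * T^(-b)], [T = r^2 - |y - z|^2], is at most
    [layer_dim n p * r^2 * a * T^(-b - 1)]. *)
Definition layer_dim (R : realType) (n : nat) (p : R) : R :=
  4 * layer_exponent p + 2 * n%:R.

(** The solution [a] of [a^(p - 1) = eps * layer_dim n p * r^(2 - p)]: the
    amplitude for which gradient and diffusion balance near the sphere. *)
Definition layer_amplitude (R : realType) (n : nat) (p eps r : R) : R :=
  (eps * layer_dim n p * r `^ (2 - p)) `^ layer_exponent p.

(** The value of the bound on the diffusion term at [T = 3 / 4 * r^2], that is,
    on the concentric sphere of radius [r / 2]. *)
Definition layer_excess (R : realType) (n : nat) (p eps r : R) : R :=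
  eps * layer_amplitude n p eps r
    * (3 / 4 * r ^+ 2) `^ (- layer_exponent p - 1) * r ^+ 2 * layer_dim n p.

(** Outside the ball of radius [r / 2] the gradient term dominates the diffusion
    term, by the choice of the amplitude.  Inside that ball the gradient may
    vanish, but there the diffusion term is at most [layer_excess]. *)
Lemma profile_supersolution (R : realType) (n : nat) (p eps r s : R) (b a T : R) :
  b = layer_exponent p -> a = layer_amplitude n p eps r -> T = r ^+ 2 - s ->
  1 < p -> 0 < eps -> 0 < r -> 0 <= s -> s < r ^+ 2 ->
  eps * (4 * (a * b * T `^ (- b - 1)) * s + 2 * n%:R * (a * T `^ (- b)))
    <= (2 * (a * T `^ (- b)) * Num.sqrt s) `^ p + layer_excess n p eps r.
Proof.
move=> bE aE TE p1 eps0 r0 s0 sr.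
rewrite /layer_excess -aE -bE; set N := layer_dim n p.
have pm : 0 < p - 1 by lra.
have b0 : 0 < b by rewrite bE invr_gt0.
have nR : 0 <= n%:R :> R by [].
have NE : N = 4 * b + 2 * n%:R by rewrite bE.
have N0 : 0 < N by rewrite NE; lra.
have T0 : 0 < T by rewrite TE subr_gt0.
have base0 : 0 < eps * N * r `^ (2 - p) by rewrite !mulr_gt0// powR_gt0.
have a0 : 0 < a by rewrite aE powR_gt0.
set tau := T `^ (- b).
have tau0 : 0 < tau by rewrite powR_gt0.
have tauT : T `^ (- b - 1) = tau / T.
  rewrite powRB; last by rewrite (gt_eqF T0) implybT.
  by rewrite powRr1// ltW.
have r20 : 0 < r ^+ 2 by rewrite exprn_gt0.
have lap : eps * (4 * (a * b * T `^ (- b - 1)) * s + 2 * n%:R * (a * tau))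
    <= eps * a * T `^ (- b - 1) * r ^+ 2 * N.
  rewrite tauT.
  have -> : eps * (4 * (a * b * (tau / T)) * s + 2 * n%:R * (a * tau))
          = eps * a * (tau / T) * (4 * b * s + 2 * n%:R * T).
    by field; rewrite gt_eqF.
  rewrite -[leRHS]mulrA ler_pM2l; last by rewrite !mulr_gt0// invr_gt0.
  have Tr : T <= r ^+ 2 by rewrite TE; lra.
  have : b * s <= b * r ^+ 2 by rewrite ler_pM2l// ltW.
  have : n%:R * T <= n%:R * r ^+ 2 by rewrite ler_wpM2l.
  by rewrite NE; lra.
apply: le_trans lap _.
have K0 : 0 <= eps * a * (3 / 4 * r ^+ 2) `^ (- b - 1) * r ^+ 2 * N.
  by rewrite !mulr_ge0 ?powR_ge0// ltW.
have G0 : 0 <= (2 * (a * tau) * Num.sqrt s) `^ p by exact: powR_ge0.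
have [s4|s4] := leP (r ^+ 2 / 4) s.
  apply: (@le_trans _ _ ((2 * (a * tau) * Num.sqrt s) `^ p)); last by rewrite lerDl.
  have sq : r / 2 <= Num.sqrt s.
    rewrite -(ler_pXn2r (n := 2)) ?nnegrE ?sqrtr_ge0 ?sqr_sqrtr//; last by rewrite ltW// divr_gt0.
    by rewrite expr_div_n; lra.
  apply: (@le_trans _ _ ((a * tau * r) `^ p)); last first.
    apply: ge0_ler_powR; rewrite ?nnegrE; first by lra.
    - by rewrite !mulr_ge0// ltW.
    - by rewrite !mulr_ge0 ?sqrtr_ge0// ltW.
    have : 0 < a * tau by rewrite mulr_gt0.
    by nra.
  have atr0 : 0 <= a * tau * r by rewrite !mulr_ge0// ltW.
  rewrite -[leRHS](mulr_powRB1 atr0); last by lra.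
  rewrite (powRM (p - 1) (x := a * tau)) ?mulr_ge0// ?(ltW a0) ?(ltW tau0) ?(ltW r0)//.
  rewrite (powRM (p - 1) (x := a)) ?(ltW a0) ?(ltW tau0)//.
  have -> : a `^ (p - 1) = eps * N * r `^ (2 - p).
    by rewrite aE -powRrM mulVf ?gt_eqF// powRr1// ltW.
  have -> : tau `^ (p - 1) = T^-1.
    by rewrite /tau -powRrM mulNr bE mulVf ?gt_eqF// powR_inv1// ltW.
  have rr : r `^ (2 - p) * r `^ (p - 1) = r.
    rewrite -powRD; last by rewrite (gt_eqF r0) implybT.
    have -> : 2 - p + (p - 1) = 1 by ring.
    by rewrite powRr1// ltW.
  rewrite tauT.
  have -> : a * tau * r * (eps * N * r `^ (2 - p) / T * r `^ (p - 1))
     = a * tau * r * eps * N / T * (r `^ (2 - p) * r `^ (p - 1)) by ring.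
  rewrite rr le_eqVlt; apply/orP; left; apply/eqP; field.
  by rewrite gt_eqF.
apply: le_trans (_ : eps * a * (3 / 4 * r ^+ 2) `^ (- b - 1) * r ^+ 2 * N <= _); last first.
  by rewrite lerDr.
rewrite !ler_pM2r// ler_pM2l ?mulr_gt0//.
rewrite -opprD !powRN lef_pV2 ?posrE ?powR_gt0//; last lra.
apply: ge0_ler_powR; rewrite ?nnegrE; [lra|lra|lra|].
by rewrite TE; lra.
Qed.

(** Since the profile [g] blows up on the sphere and [v] is bounded on the closed
    ball, [v] minus the profile attains its maximum inside, where both functions
    are smooth.  There the equation for [v] contradicts the supersolution property
    of the profile. *)
Lemma interior_ball_comparison (R : realType) (n : nat) (Om : set 'rV[R]_n)
    (p eps r F : R) (f v : 'rV[R]_n -> R) (z : 'rV[R]_n) (g : R -> R) :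
  let a := layer_amplitude n p eps r in
  let b := layer_exponent p in
  open Om -> C2_on Om v ->
  (forall x, Om x -> v x + enorm (grad v x) `^ p - f x - eps * laplacian v x = 0) ->
  1 < p -> 0 < eps -> 0 < r -> 0 <= F ->
  (forall w, enorm (w - z) <= r -> Om w) ->
  (forall w, enorm (w - z) <= r -> f w <= F) ->
  (forall s, s < r ^+ 2 -> is_derive s 1 g (a * (r ^+ 2 - s) `^ (- b))) ->
  (forall s, 0 <= s -> s < r ^+ 2 -> 0 <= g s) ->
  (forall M, exists2 s1, s1 < r ^+ 2 & forall s, s1 <= s -> s < r ^+ 2 -> M <= g s) ->
  forall x, sqn (x - z) < r ^+ 2 ->
    v x <= g (sqn (x - z)) + F + layer_excess n p eps r.
Proof.
move=> a b oOm C2v pde p1 eps0 r0 F0 zOm fF dg g0 gblow x xr.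
set K := layer_excess n p eps r.
have inb w : sqn (w - z) <= r ^+ 2 -> enorm (w - z) <= r.
  by move=> H; rewrite enorm_le// ltW.
have K0 : 0 <= K.
  rewrite /K /layer_excess /layer_dim /layer_exponent.
  rewrite !mulr_ge0 ?powR_ge0 ?addr_ge0 ?mulr_ge0 ?invr_ge0 ?sqr_ge0 ?(ltW eps0)//; lra.
rewrite leNgt; apply/negP => contra.
have cv (w : 'rV[R]_n) : sqn (w - z) <= r ^+ 2 -> {for w, continuous v}.
  by move=> /inb/zOm; exact: C2_continuous.
have [V VP] : exists V, forall w, sqn (w - z) <= r ^+ 2 -> v w <= V.
  have [||c _ cP] := @compact_EVT_max _ R v [set w | sqn (w - z) <= r ^+ 2] _ (@compact_sqn_ball R n z (r ^+ 2)).
  - by exists x; exact: ltW.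
  - by apply: continuous_in_subspaceT => w; rewrite inE => /cv.
  by exists (v c) => w wz; apply: cP; rewrite inE.
(* Beyond [s1] the profile exceeds [v], so the maximum over the compact ball
   [sqn (w - z) <= Rm] is reached in its interior. *)
have [s1 s1r s1P] := gblow V.
pose Rm := Num.max s1 (sqn (x - z)).
have Rmr : Rm < r ^+ 2 by rewrite gt_max s1r.
pose phi w := v w - g (sqn (w - z)).
have [||x0 + x0P] := @compact_EVT_max _ R phi [set w | sqn (w - z) <= Rm] _ (@compact_sqn_ball R n z Rm).
- by exists x; rewrite /= le_max lexx orbT.
- apply: continuous_in_subspaceT => w; rewrite inE => wz.
  have wr : sqn (w - z) < r ^+ 2 by exact: le_lt_trans wz Rmr.
  apply: continuousB; first exact/cv/ltW.
  apply: (@continuous_comp _ _ _ (fun w : 'rV[R]_n => sqn (w - z)) g); first exact: sqn_sub_continuous.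
  apply: differentiable_continuous; apply/derivable1_diffP.
  exact: (@ex_derive _ _ _ _ _ _ _ (dg _ wr)).
rewrite inE /= => x0R.
have x0r : sqn (x0 - z) < r ^+ 2 by exact: le_lt_trans x0R Rmr.
have phix : F + K < phi x0.
  apply: (@lt_le_trans _ _ (phi x)); first by rewrite /phi; lra.
  by apply: x0P; rewrite inE /= le_max lexx orbT.
have s0 := sqn_ge0 (x0 - z).
have x0s1 : sqn (x0 - z) < s1.
  rewrite ltNge; apply/negP => /s1P/(_ x0r) H.
  have := VP x0 (ltW x0r); rewrite /phi in phix; lra.
have Omx0 : Om x0 by exact/zOm/inb/ltW.
have [|||gradE lapE] := @radial_touching R n Om v x0 z g
  (fun s => a * (r ^+ 2 - s) `^ (- b)) (a * b * (r ^+ 2 - sqn (x0 - z)) `^ (- b - 1)) 1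
  oOm C2v Omx0 (oner_neq0 _).
- apply/nbhs_ballP; exists (r ^+ 2 - sqn (x0 - z)); first by rewrite /= subr_gt0.
  move=> s; rewrite -ball_normE/= distrC => H; apply: dg.
  by have := ler_norm (s - sqn (x0 - z)); lra.
- exact: is_derive_profile.
- have [e e0 eP] : exists2 e : R, 0 < e & forall w, `|w - x0| < e -> sqn (w - z) < s1.
    have nb : \forall w \near x0, sqn (w - z) < s1.
      exact: (cvgr_lt (sqn (x0 - z)) (@sqn_sub_continuous R n z x0) _ x0s1).
    have [e /= e0 eP] := iffLR (nbhs_ballP _ _) nb.
    by exists e => // w wx; apply: eP; rewrite -ball_normE/= distrC.
  apply/nbhs_ballP; exists e => // w; rewrite -ball_normE/= distrC => /eP ws.
  by rewrite !mul1r; apply: x0P; rewrite inE /= le_max (ltW ws).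
rewrite !mul1r in lapE.
have sup := @profile_supersolution R n p eps r (sqn (x0 - z)) b a _ erefl erefl erefl p1 eps0 r0 s0 x0r.
have := pde x0 Omx0; rewrite gradE enormZ; last first.
  by rewrite !mulr_ge0 ?powR_ge0.
rewrite -/(enorm (x0 - z)) in sup.
have : eps * laplacian v x0 <= eps * (4 * (a * b * (r ^+ 2 - sqn (x0 - z)) `^ (- b - 1)) * sqn (x0 - z) +
      2 * n%:R * (a * (r ^+ 2 - sqn (x0 - z)) `^ (- b))) by rewrite ler_pM2l.
have := fF x0 (inb _ (ltW x0r)); have := g0 _ s0 x0r.
rewrite /phi in phix.
rewrite -/K in sup.
rewrite /enorm -/(sqn _).
move: sup; set P1 := (_ `^ p); set Q := eps * _ => *.
lra.
Qed.

(** Up to a constant, a primitive of [a * T^(-b)] at [T = c * h * r], with [a] the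
    layer amplitude.  When [p < 2] the powers of [r] cancel.  When [p = 2] the
    primitive is logarithmic, and [h] alone is kept since [r] is at most [c]. *)
Definition layer (R : realType) (n : nat) (p c eps h : R) : R :=
  let b := layer_exponent p in
  let alpha := (2 - p) / (p - 1) in
  if p < 2 then
    layer_dim n p `^ b * c `^ (- alpha) / alpha * (eps `^ b * h `^ (- alpha))
  else eps * layer_dim n p * - ln h.

Lemma layer_dim_gt0 (R : realType) (n : nat) (p : R) : 1 < p -> 0 < layer_dim n p.
Proof.
move=> p1; have b0 : 0 < layer_exponent p by rewrite invr_gt0 subr_gt0.
by have := ler0n R n; rewrite /layer_dim; lra.
Qed.

Lemma layer_amplitude_gt0 (R : realType) (n : nat) (p eps r : R) :
  1 < p -> 0 < eps -> 0 < r -> 0 < layer_amplitude n p eps r.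
Proof.
by move=> p1 e0 r0; rewrite powR_gt0// !mulr_gt0 ?powR_gt0// layer_dim_gt0.
Qed.

(** The radius [c * sqrt eps] is chosen so that the amplitude times [(r^2)^(-b)]
    is bounded, which leaves an excess of order [eps]. *)
Lemma layer_excess_le (R : realType) (n : nat) (p c : R) :
  1 < p -> p <= 2 -> 0 < c -> c <= 1 ->
  exists2 C : R, 0 <= C & forall eps, 0 < eps -> eps < 1 ->
    layer_excess n p eps (c * Num.sqrt eps) <= C * Num.sqrt eps.
Proof.
move=> p1 p2 c0 c1; set b := layer_exponent p; set N := layer_dim n p.
have b0 : 0 < b by rewrite invr_gt0 subr_gt0.
have N0 : 0 < N by exact: layer_dim_gt0.
exists ((3 / 4) `^ (- b - 1) * N * (N / c ^+ 2) `^ b).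
  by rewrite !mulr_ge0 ?powR_ge0// ltW.
move=> eps e0 e1; set sg := Num.sqrt eps.
have sg0 : 0 < sg by rewrite sqrtr_gt0.
have sge : sg ^+ 2 = eps by rewrite sqr_sqrtr// ltW.
have sg1 : sg <= 1 by nra.
have r0 : 0 < c * sg by rewrite mulr_gt0.
have r20 : 0 < (c * sg) ^+ 2 by rewrite exprn_gt0.
have -> : layer_excess n p eps (c * sg) =
    (3 / 4) `^ (- b - 1) * N * (layer_amplitude n p eps (c * sg) * ((c * sg) ^+ 2) `^ (- b)) * eps.
  rewrite /layer_excess -/b -/N powRM; [|lra|exact: ltW].
  have -> : ((c * sg) ^+ 2) `^ (- b - 1) = ((c * sg) ^+ 2) `^ (- b) / (c * sg) ^+ 2.
    rewrite powRB; last by rewrite (gt_eqF r20) implybT.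
    by rewrite powRr1// ltW.
  by field; rewrite !gt_eqF.
apply: ler_pM => //; last 1 first.
- by rewrite -sge; nra.
- by rewrite !mulr_ge0 ?powR_ge0// ltW.
- exact: ltW.
apply: ler_pM => //; first by rewrite !mulr_ge0 ?powR_ge0// ltW.
  by rewrite mulr_ge0 ?powR_ge0.
rewrite /layer_amplitude -/b -/N powRN.
have Y0 : 0 < ((c * sg) ^+ 2) `^ b by rewrite powR_gt0.
have Nc0 : 0 <= N / c ^+ 2 by rewrite divr_ge0 ?sqr_ge0// ltW.
rewrite ler_pdivrMr// -(powRM b Nc0 (ltW r20)).
apply: ge0_ler_powR; rewrite ?nnegrE ?(ltW b0)//.
- by rewrite !mulr_ge0 ?powR_ge0// ltW.
- by rewrite mulr_ge0// ltW.
have -> : N / c ^+ 2 * (c * sg) ^+ 2 = eps * N * 1.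
  by rewrite -sge; field; rewrite gt_eqF.
rewrite ler_pM2l ?mulr_gt0//.
apply: (@le_trans _ _ ((c * sg) `^ 0)); last by rewrite powRr0.
apply: ger_powR; last by lra.
by rewrite r0/=; nra.
Qed.

(** The profile is the primitive [a / alpha * T^(-alpha)], which blows up because
    [alpha > 0]. *)
Lemma layer_profile_sub (R : realType) (n : nat) (Om : set 'rV[R]_n)
    (p eps r F c h : R) (f v : 'rV[R]_n -> R) (z x : 'rV[R]_n) :
  open Om -> C2_on Om v ->
  (forall x, Om x -> v x + enorm (grad v x) `^ p - f x - eps * laplacian v x = 0) ->
  1 < p -> p < 2 -> 0 < eps -> 0 < r -> 0 <= F ->
  (forall w, enorm (w - z) <= r -> Om w) ->
  (forall w, enorm (w - z) <= r -> f w <= F) ->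
  0 < c -> 0 < h -> c * h * r <= r ^+ 2 - sqn (x - z) ->
  v x <= layer n p c eps h + F + layer_excess n p eps r.
Proof.
move=> oOm C2v pde p1 p2 eps0 r0 F0 zOm fF c0 h0 xz.
set a := layer_amplitude n p eps r.
set b := layer_exponent p.
set alpha := (2 - p) / (p - 1).
have al0 : 0 < alpha by rewrite divr_gt0 ?subr_gt0.
have pm : 0 < p - 1 by lra.
have bE : b = alpha + 1.
  by rewrite /b /layer_exponent /alpha; field; rewrite gt_eqF.
have a0 : 0 < a by exact: layer_amplitude_gt0.
have chr : 0 < c * h * r by rewrite !mulr_gt0.
have N0 := layer_dim_gt0 n p1.
have := @interior_ball_comparison R n Om p eps r F f v z
  (fun s => a / alpha * (r ^+ 2 - s) `^ (- alpha)) oOm C2v pde p1 eps0 r0 F0 zOm fF.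
rewrite -/a -/b => cmp.
apply: le_trans (cmp _ _ _ x _) _ => {cmp}.
- move=> s sr; apply: is_derive_eq (is_derive_profile (a / alpha) alpha sr) _.
  by rewrite divfK ?gt_eqF// bE opprD.
- by move=> s _ _; rewrite mulr_ge0 ?powR_ge0// divr_ge0// ltW.
- move=> M; pose Q := Num.max M 1 * alpha / a.
  have Q0 : 0 < Q.
    by rewrite divr_gt0// mulr_gt0// lt_max ltr01 orbT.
  have Qp : 0 < Q `^ (- alpha^-1) by exact: powR_gt0.
  exists (r ^+ 2 - Q `^ (- alpha^-1)); first by rewrite ltrBlDr ltrDl.
  move=> s s1 sr.
  have : Q <= (r ^+ 2 - s) `^ (- alpha).
    have -> : Q = (Q `^ (- alpha^-1)) `^ (- alpha).
      by rewrite -powRrM mulrNN mulVf ?gt_eqF// powRr1// ltW.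
    rewrite !powRN lef_pV2 ?posrE ?powR_gt0 ?subr_gt0//; last by rewrite -powRN.
    rewrite -powRN; apply: ge0_ler_powR; rewrite ?nnegrE; lra.
  move=> H; apply: le_trans (_ : a / alpha * Q <= _); last by rewrite ler_pM2l// divr_gt0.
  have -> : a / alpha * Q = Num.max M 1 by rewrite /Q; field; rewrite !gt_eqF.
  by rewrite le_max lexx.
- lra.
rewrite !lerD2r /layer p2 -/alpha -/b.
apply: (@le_trans _ _ (a / alpha * (c * h * r) `^ (- alpha))).
  apply: ler_wpM2l; first by rewrite ltW// divr_gt0.
  rewrite !powRN lef_pV2 ?posrE ?powR_gt0//; last lra.
  by apply: ge0_ler_powR; rewrite ?nnegrE; lra.
have ab : (2 - p) * b = alpha by rewrite /b /alpha.
have -> : a = layer_dim n p `^ b * (eps `^ b * r `^ alpha).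
  rewrite /a /layer_amplitude -/b powRM ?mulr_ge0 ?powR_ge0 ?(ltW eps0) ?(ltW N0)//.
  rewrite powRM ?(ltW eps0) ?(ltW N0)// -powRrM ab; ring.
rewrite powRM ?mulr_ge0 ?(ltW c0) ?(ltW h0) ?(ltW r0)//.
rewrite powRM ?(ltW c0) ?(ltW h0)// (powRN r).
have rp : r `^ alpha != 0 by rewrite gt_eqF// powR_gt0.
rewrite le_eqVlt; apply/orP; left; apply/eqP; field.
by rewrite rp gt_eqF.
Qed.

(** The exponent is [b = 1] when [p = 2], so the profile is logarithmic; it is
    normalized to vanish at the centre of the ball. *)
Lemma layer_profile_quad (R : realType) (n : nat) (Om : set 'rV[R]_n)
    (eps sg F c h : R) (f v : 'rV[R]_n -> R) (z x : 'rV[R]_n) :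
  open Om -> C2_on Om v ->
  (forall x, Om x -> v x + enorm (grad v x) `^ 2 - f x - eps * laplacian v x = 0) ->
  0 < eps -> 0 < sg -> sg <= 1 -> 0 <= F ->
  (forall w, enorm (w - z) <= c * sg -> Om w) ->
  (forall w, enorm (w - z) <= c * sg -> f w <= F) ->
  0 < c -> 0 < h -> c * h * (c * sg) <= (c * sg) ^+ 2 - sqn (x - z) ->
  v x <= layer n 2 c eps h + F + layer_excess n 2 eps (c * sg).
Proof.
move=> oOm C2v pde eps0 sg0 sg1 F0 zOm fF c0 h0 xz.
set r := c * sg in zOm fF xz *.
have r0 : 0 < r by rewrite mulr_gt0.
have p1 : 1 < 2 :> R by lra.
have N0 := layer_dim_gt0 n p1.
have r20 : 0 < r ^+ 2 by rewrite exprn_gt0.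
have bE : layer_exponent 2 = 1 :> R.
  by rewrite /layer_exponent (_ : 2 - 1 = 1) ?invr1//; ring.
set a := layer_amplitude n 2 eps r.
have aE : a = eps * layer_dim n 2.
  rewrite /a /layer_amplitude bE subrr powRr0 mulr1 powRr1//.
  by rewrite mulr_ge0// ltW.
have a0 : 0 < a by rewrite aE mulr_gt0.
have := @interior_ball_comparison R n Om 2 eps r F f v z
  (fun s => a * (ln (r ^+ 2) - ln (r ^+ 2 - s))) oOm C2v pde p1 eps0 r0 F0 zOm fF.
rewrite -/a bE => cmp.
have chr : 0 < c * h * r by rewrite !mulr_gt0.
apply: le_trans (cmp _ _ _ x _) _ => {cmp}.
- move=> s sr.
  have T0 : 0 < r ^+ 2 - s by rewrite subr_gt0.
  have d1 : is_derive s 1 (fun s : R => r ^+ 2 - s) (- 1).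
    rewrite (_ : (fun _ => _) = cst (r ^+ 2) - id)//.
    by apply: is_derive_eq; rewrite sub0r.
  have d2 := @is_derive1_comp _ (@ln R) (fun s => r ^+ 2 - s) s _ _ (is_derive1_ln T0) d1.
  have d3 := is_deriveZ a (is_deriveB (is_derive_cst (ln (r ^+ 2)) s 1) d2).
  apply: (is_derive_eq d3); rewrite /GRing.scale/= powR_inv1 ?(ltW T0)//; ring.
- move=> s s0 sr; rewrite mulr_ge0 ?(ltW a0)// subr_ge0 ler_ln ?posrE//; lra.
- move=> M; exists (r ^+ 2 - r ^+ 2 * expR (- (M / a))).
    by rewrite ltrBlDr ltrDl mulr_gt0// expR_gt0.
  move=> s s1 sr; have T0 : 0 < r ^+ 2 - s by rewrite subr_gt0.
  have : ln (r ^+ 2 - s) <= ln (r ^+ 2 * expR (- (M / a))).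
    by rewrite ler_ln ?posrE ?mulr_gt0 ?expR_gt0//; lra.
  rewrite lnM ?posrE ?expR_gt0// expRK => H.
  have -> : M = a * (M / a) by field; rewrite gt_eqF.
  by rewrite ler_pM2l//; lra.
- lra.
rewrite !lerD2r /layer ltxx -aE ler_pM2l//.
have : ln (c * h * r) <= ln (r ^+ 2 - sqn (x - z)).
  by rewrite ler_ln ?posrE//; lra.
have sgl : ln sg <= 0 by exact: ln_le0.
have lr : ln r = ln c + ln sg by rewrite lnM ?posrE.
have l2 : ln (r ^+ 2) = ln r *+ 2 by rewrite lnXn.
have l3 : ln (c * h * r) = ln c + ln h + ln r.
  by rewrite lnM ?posrE ?mulr_gt0// lnM ?posrE.
by rewrite l3 l2 lr => H; lra.
Qed.

(** * A priori bounds for the two problems *)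

Lemma partial_quadratic (R : realType) (n : nat) (k : R) (a : 'rV[R]_n) (i : 'I_n) :
  partial i (fun x : 'rV[R]_n => k * sqn (x - a)) = fun x => 2 * k * (x - a) 0 i.
Proof.
apply/funext => x; rewrite /partial /derive.
have -> : (fun h : R => h^-1 *: (((fun x : 'rV[R]_n => k * sqn (x - a)) \o shift x)
      (h *: delta_mx 0 i) - k * sqn (x - a))) =
    (fun h => h^-1 * (h * (2 * k * (x - a) 0 i + k * h))).
  apply/funext => h /=; rewrite [h *: _ + x]addrC addrAC sqn_line /GRing.scale/=.
  by congr (_ * _); ring.
apply: cvg_lim => //.
have E : \forall h \near (0 : R)^', 2 * k * (x - a) 0 i + k * h =
    h^-1 * (h * (2 * k * (x - a) 0 i + k * h)).
  by exists 1 => //= h _ h0; rewrite mulKf.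
apply: cvg_trans (near_eq_cvg E) _.
have L : 2 * k * (x - a) 0 i + k * h @[h --> (0 : R)^'] --> 2 * k * (x - a) 0 i.
  rewrite -[X in _ --> X]addr0; apply: cvgD; first exact: cvg_cst.
  rewrite -[X in _ --> X](mulr0 k); apply: cvgMl_tmp.
  by move=> A; exact: nbhs_dnbhs.
exact: L.
Qed.

Lemma C1_quadratic (R : realType) (n : nat) (A : set 'rV[R]_n) (k : R) (a : 'rV[R]_n) :
  C1_on A (fun x : 'rV[R]_n => k * sqn (x - a)).
Proof.
move=> x _; split=> [|i].
  have -> : (fun x : 'rV[R]_n => k * sqn (x - a)) =
      k \*: (\sum_(i < n) (fun v : 'rV[R]_n => v 0 i - a 0 i : R) ^+ 2).
    apply/funext => v /=; rewrite fct_sumE; congr (_ * _); apply: eq_bigr => i _.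
    by rewrite !mxE.
  apply: differentiableZ; apply: differentiable_sum => i; apply: differentiableX.
  by apply: differentiableB; [exact: differentiable_coord|exact: differentiable_cst].
rewrite partial_quadratic.
have -> : (fun x : 'rV[R]_n => 2 * k * (x - a) 0 i) =
    (2 * k) \*: (fun x : 'rV[R]_n => x 0 i - a 0 i : R).
  by apply/funext => v; rewrite /GRing.scale/= !mxE.
apply: differentiable_continuous; apply: differentiableZ.
by apply: differentiableB; [exact: differentiable_coord|exact: differentiable_cst].
Qed.

Lemma grad_quadratic (R : realType) (n : nat) (k : R) (a x : 'rV[R]_n) :
  grad (fun x : 'rV[R]_n => k * sqn (x - a)) x = (2 * k) *: (x - a).
Proof. by apply/rowP => i; rewrite mxE partial_quadratic !mxE. Qed.

Lemma C1_closure_quadratic (R : realType) (n : nat) (Om : set 'rV[R]_n) (k : R)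
    (a : 'rV[R]_n) :
  C1_closure Om (fun x : 'rV[R]_n => k * sqn (x - a)) (fun x => (2 * k) *: (x - a)).
Proof.
split.
- apply: continuous_subspaceT => x.
  by have [] := @C1_quadratic R n setT k a x I; move=> /differentiable_continuous.
- exact: C1_quadratic.
- by move=> x _; exact: grad_quadratic.
- apply: continuous_subspaceT => x.
  have cB : {for x, continuous (fun x : 'rV[R]_n => x - a)}.
    by apply: continuousB; [exact: cvg_id|exact: cst_continuous].
  exact: (continuousZl_tmp cB).
Qed.

Lemma compact_inner (R : realType) (n : nat) (Om : set 'rV[R]_n) (delta : R) :
  bounded_set Om -> 0 < delta ->
  compact [set x | forall b, ~ Om b -> delta <= enorm (x - b)].
Proof.
move=> [M [Mr MP]] d0; apply: bounded_closed_compact.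
  exists M; split => // N MN x xP; apply: (MP N MN); apply: contrapT => /xP.
  by rewrite subrr /enorm -/(sqn _) sqn0 sqrtr0 leNgt d0.
have -> : [set x | forall b, ~ Om b -> delta <= enorm (x - b)] =
    \bigcap_(b in ~` Om) [set x : 'rV[R]_n | delta <= enorm (x - b)] by [].
apply: closed_bigI => b _.
apply: (@closed_comp _ _ (fun x : 'rV[R]_n => enorm (x - b)) [set t | delta <= t]); last exact: closed_ge.
move=> x _; apply: (@continuous_comp _ _ _ (fun x : 'rV[R]_n => sqn (x - b)) Num.sqrt).
  exact: sqn_sub_continuous.
exact: sqrt_continuous.
Qed.

Lemma dist_to_le (R : realType) (n : nat) (A : set 'rV[R]_n) (x b : 'rV[R]_n) :
  A b -> dist_to A x <= enorm (x - b).
Proof.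
move=> Ab; apply: ge_inf; last by exists b.
by exists 0 => _ [y _ <-]; exact: enorm_ge0.
Qed.

(** A segment that leaves [Om] meets the boundary, so closeness to the complement
    implies closeness to the boundary. *)
Lemma blowup_near_complement (R : realType) (n : nat) (Om : set 'rV[R]_n)
    (p eps : R) (f v : 'rV[R]_n -> R) (M : R) :
  open Om -> is_PDE_eps_solution Om p f eps v ->
  exists2 delta, 0 < delta & forall x b, Om x -> ~ Om b -> enorm (x - b) < delta -> M < v x.
Proof.
move=> oOm [_ _ /(_ M)[delta d0 dP]]; exists delta => // x b Omx nOmb xb.
have [c bc xc] := boundary_point_between oOm Omx nOmb.
apply: dP => //; apply: le_lt_trans (dist_to_le _ bc) _.
exact: le_lt_trans xc xb.
Qed.

(** At an interior minimum the gradient vanishes and the Laplacian is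
    nonnegative, so the equation gives [v >= f] there. *)
Lemma large_solution_ge0 (R : realType) (n : nat) (Om : set 'rV[R]_n)
    (p eps : R) (f v : 'rV[R]_n -> R) :
  open Om -> bounded_set Om -> (forall x, Om x -> 0 <= f x) -> 1 < p -> 0 < eps ->
  is_PDE_eps_solution Om p f eps v -> forall x, Om x -> 0 <= v x.
Proof.
move=> oOm bOm f0 p1 eps0 sol x1 Omx1; rewrite leNgt; apply/negP => vx1.
have [delta d0 dP] := blowup_near_complement 0 oOm sol.
have [C2v pde _] := sol.
pose K := [set x | forall b, ~ Om b -> delta <= enorm (x - b)].
have KOm x : K x -> Om x.
  move=> xP; apply: contrapT => /xP.
  by rewrite subrr /enorm -/(sqn _) sqn0 sqrtr0 leNgt d0.
have nK x : Om x -> ~ K x -> 0 < v x.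
  move=> Omx /existsNP[b /not_implyP[nOmb /negP]]; rewrite -ltNge; exact: dP.
have Kx1 : K x1.
  by apply: contrapT => /(nK _ Omx1); rewrite ltNge ltW.
have [||x0] := @compact_EVT_min _ R v K _ (compact_inner bOm d0).
- by exists x1.
- apply: continuous_in_subspaceT => x; rewrite inE => /KOm; exact: C2_continuous.
rewrite inE => Kx0 x0P.
have Omx0 := KOm _ Kx0.
have vx0 : v x0 < 0 by apply: le_lt_trans (x0P x1 _) vx1; rewrite inE.
have mn : \forall x \near x0,
    -1 * (v x - 0 * sqn (x - x0)) <= -1 * (v x0 - 0 * sqn (x0 - x0)).
  have nOm := open_nbhs_nbhs (conj oOm Omx0).
  near=> x; rewrite !mul0r !subr0 !mulN1r lerN2.
  have Omx : Om x by near: x.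
  have [Kx|/(nK _ Omx) vx] := pselect (K x); first by apply: x0P; rewrite inE.
  by apply: ltW; exact: lt_trans vx0 vx.
have N1 : -1 != 0 :> R by rewrite oppr_eq0 oner_eq0.
have [gE lE] := quadratic_touching oOm C2v Omx0 N1 mn.
have := pde _ Omx0; rewrite gE mulr0 scale0r /enorm -/(sqn _) sqn0 sqrtr0 powR0; last by rewrite gt_eqF//; lra.
have : 0 <= laplacian v x0 by move: lE; lra.
move=> l0; have := mulr_ge0 (ltW eps0) l0; have := f0 _ Omx0; lra.
Unshelve. all: by end_near. Qed.

(** The supersolution test is available up to the boundary, so a constant can be
    used at a minimum of [u] over the closure. *)
Lemma state_constraint_ge0 (R : realType) (n : nat) (Om : set 'rV[R]_n)
    (p : R) (f u : 'rV[R]_n -> R) :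
  bounded_set Om -> (forall x, closure Om x -> 0 <= f x) -> 1 < p ->
  is_PDE0_solution Om p f u -> forall x, closure Om x -> 0 <= u x.
Proof.
move=> bOm f0 p1 [cu _ super] x1 clx1.
have [||x0] := @compact_EVT_min _ R u (closure Om) _ (compact_closure_bounded bOm).
- by exists x1.
- exact: cu.
rewrite inE => clx0 x0P; apply: le_trans (x0P x1 _); last by rewrite inE.
have := super _ _ (@C1_closure_quadratic R n Om 0 0) x0 clx0.
rewrite mulr0 scale0r /enorm -/(sqn _) sqn0 sqrtr0 powR0; last by rewrite gt_eqF//; lra.
have := f0 _ clx0 => fx0 H; have : 0 <= u x0 + 0 - f x0.
  apply: H => x clx; rewrite !mul0r !subr0; apply: x0P; by rewrite inE.
lra.
Qed.

Lemma lipschitz_nonneg (R : realType) (n : nat) (A : set 'rV[R]_n) (f : 'rV[R]_n -> R) :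
  lipschitz_euclid A f ->
  exists2 L : R, 0 <= L & forall x y, A x -> A y -> f x <= f y + L * enorm (x - y).
Proof.
move=> [L LP]; exists `|L| => // x y Ax Ay; have := LP x y Ax Ay => H.
rewrite -lerBlDl; apply: le_trans (ler_norm _) _; apply: le_trans H _.
by rewrite ler_wpM2r ?enorm_ge0// ler_norm.
Qed.

(** Paraboloids centred at [x1] with a large opening touch [u] from above at
    points close to [x1], and at such points the subsolution test gives
    [u <= f]. *)
Lemma subsolution_le (R : realType) (n : nat) (Om : set 'rV[R]_n)
    (p : R) (f u : 'rV[R]_n -> R) :
  open Om -> bounded_set Om -> lipschitz_euclid (closure Om) f ->
  {within closure Om, continuous u} -> viscosity_subsolution Om p f u ->
  forall x, Om x -> u x <= f x.
Proof.
move=> oOm bOm /lipschitz_nonneg[L L0 LP] cu sub x1 Omx1.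
have clO x : Om x -> closure Om x by exact: subset_closure.
have cK := compact_closure_bounded bOm.
have K0 : closure Om !=set0 by exists x1; exact: clO.
have [xM _ MP] := compact_EVT_max K0 cK cu.
have B0 : 0 <= u xM - u x1 by rewrite subr_ge0 MP// inE; exact: clO.
apply/ler_addgt0Pr => e e0.
have [rho /= rho0 rhoP] := iffLR (nbhs_ballP _ _) (open_nbhs_nbhs (conj oOm Omx1)).
pose r := Num.min (rho / 2) (e / (L + 1)).
have L1 : 0 < L + 1 by lra.
have r0 : 0 < r by rewrite lt_min !divr_gt0.
have rrho : r < rho.
  have : r <= rho / 2 by rewrite ge_min lexx.
  by lra.
have rL : L * r <= e.
  have : r <= e / (L + 1) by rewrite ge_min lexx orbT.
  by rewrite ler_pdivlMr//; nra.
pose k := (u xM - u x1 + 1) / r ^+ 2.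
have r20 : 0 < r ^+ 2 by rewrite exprn_gt0.
have kr : k * r ^+ 2 = u xM - u x1 + 1 by rewrite divfK// gt_eqF.
have k0 : 0 < k by rewrite divr_gt0//; lra.
have [|x0] := compact_EVT_max K0 cK (_ : {within closure Om, continuous (fun x => u x - k * sqn (x - x1))}).
  apply/subspace_continuousP => x clx; apply: cvgB.
    exact: (iffLR (subspace_continuousP _ _) cu x clx).
  have [H _ _ _] := @C1_closure_quadratic R n Om k x1.
  exact: (iffLR (subspace_continuousP _ _) H x clx).
rewrite inE => clx0 x0P.
have H1 : u x1 <= u x0 - k * sqn (x0 - x1).
  by have := x0P x1; rewrite inE subrr sqn0 mulr0 subr0; apply; exact: clO.
have H2 : u x0 <= u xM by apply: MP; rewrite inE.
have x01 : enorm (x0 - x1) <= r.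
  rewrite enorm_le ?(ltW r0)// leNgt; apply/negP => H.
  have : k * r ^+ 2 < k * sqn (x0 - x1) by rewrite ltr_pM2l.
  by lra.
have Omx0 : Om x0.
  apply: rhoP; rewrite -ball_normE/= distrC; apply: le_lt_trans (norm_le_enorm _) _.
  exact: le_lt_trans x01 rrho.
have := sub _ (@C1_quadratic R n Om k x1) x0 Omx0.
have mx x : Om x -> u x - k * sqn (x - x1) <= u x0 - k * sqn (x0 - x1).
  by move=> Omx; apply: x0P; rewrite inE; exact: clO.
move=> /(_ mx) H4.
have H5 := powR_ge0 (enorm (grad (fun x : 'rV[R]_n => k * sqn (x - x1)) x0)) p.
have := LP x0 x1 clx0 (clO _ Omx1).
have : L * enorm (x0 - x1) <= L * r by rewrite ler_wpM2l.
have : 0 <= k * sqn (x0 - x1) by rewrite mulr_ge0 ?sqn_ge0// ltW.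
lra.
Qed.

Lemma subsolution_le_closure (R : realType) (n : nat) (Om : set 'rV[R]_n)
    (p : R) (f u : 'rV[R]_n -> R) :
  open Om -> bounded_set Om -> lipschitz_euclid (closure Om) f ->
  {within closure Om, continuous u} -> viscosity_subsolution Om p f u ->
  forall x, closure Om x -> u x <= f x.
Proof.
move=> oOm bOm Lf cu sub b clb.
have uf := subsolution_le oOm bOm Lf cu sub.
have [L L0 LP] := lipschitz_nonneg Lf.
have clO x : Om x -> closure Om x by exact: subset_closure.
apply/ler_addgt0Pr => e e0.
have e2 : 0 < e / 2 by rewrite divr_gt0.
have := iffLR (subspace_continuousP _ u) cu b clb => cub.
have n1 : nbhs b [set x | closure Om x -> `|u b - u x| < e / 2].
  have := cub _ (nbhsx_ballx (u b) (e / 2) e2).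
  by rewrite /nbhs/= /within/=.
have eL : 0 < e / (2 * (L + 1) * (n%:R + 1)).
  by rewrite divr_gt0// !mulr_gt0// ?ltr_wpDl//; lra.
have [x [Omx [/(_ (clO _ Omx)) ux bx]]] := clb _ (filterI n1 (nbhsx_ballx b _ eL)).
have := uf x Omx; have := LP x b (clO _ Omx) clb.
have : L * enorm (x - b) <= e / 2.
  apply: le_trans (_ : L * ((n%:R + 1) * `|x - b|) <= _).
    by rewrite ler_wpM2l// enorm_le_norm.
  move: bx; rewrite -ball_normE/= distrC ltr_pdivlMr; last first.
    by rewrite !mulr_gt0// ?ltr_wpDl//; lra.
  have : 0 <= (n%:R + 1) * `|x - b| by rewrite mulr_ge0// addr_ge0.
  have -> : `|x - b| * (2 * (L + 1) * (n%:R + 1)) = 2 * (L + 1) * ((n%:R + 1) * `|x - b|).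
    by ring.
  by move: (_ * `|_|) => z; nra.
have := ler_norm (u b - u x); lra.
Qed.

(** * Doubling of variables *)

Lemma doubling_max (R : realType) (n : nat) (A B : set 'rV[R]_n)
    (v w : 'rV[R]_n -> R) (k : R) :
  A !=set0 -> B !=set0 -> compact A -> compact B ->
  {within A, continuous v} -> {within B, continuous w} ->
  exists x0 y0, [/\ A x0, B y0 & forall x y, A x -> B y ->
     v x - w y - k * sqn (x - y) <= v x0 - w y0 - k * sqn (x0 - y0)].
Proof.
move=> [a Aa] [b Bb] cA cB cv cw.
pose phi (z : 'rV[R]_n * 'rV[R]_n) := v z.1 - w z.2 - k * sqn (z.1 - z.2).
have cphi : {within A `*` B, continuous phi}.
  apply/subspace_continuousP => -[x y] /= [Ax By].
  have c1 : v z.1 @[z --> within (A `*` B) (nbhs (x, y))] --> v x.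
    move=> W /(iffLR (subspace_continuousP _ _) cv x Ax) nW.
    exists ([set x' | A x' -> W (v x')], setT); first by split => //; exact: filterT.
    by move=> [x' y'] /= [+ _] [Ax' _]; apply.
  have c2 : w z.2 @[z --> within (A `*` B) (nbhs (x, y))] --> w y.
    move=> W /(iffLR (subspace_continuousP _ _) cw y By) nW.
    exists (setT, [set y' | B y' -> W (w y')]); first by split => //; exact: filterT.
    by move=> [x' y'] /= [_ +] [_ By']; apply.
  have c3 : sqn (z.1 - z.2) @[z --> within (A `*` B) (nbhs (x, y))] --> sqn (x - y).
    apply: cvg_within_filter.
    have H : z.1 - z.2 @[z --> nbhs (x, y)] --> x - y.
      by apply: cvgB; [exact: cvg_fst|exact: cvg_snd].
    exact: (cvg_comp _ _ H (@sqn_continuous R n (x - y))).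
  by apply: cvgB; [exact: cvgB|exact: cvgMl_tmp].
have AB0 : A `*` B !=set0 by exists (a, b).
have [[x0 y0]] := compact_EVT_max AB0 (compact_setX cA cB) cphi.
rewrite inE => -[/= Ax0 By0] mx; exists x0, y0; split => // x y Ax By.
by apply: (mx (x, y)); rewrite inE.
Qed.

Lemma powR_le_bound (R : realType) (p t F : R) :
  1 < p -> 0 <= t -> 0 <= F -> t `^ p <= F -> t <= 1 + F.
Proof.
move=> p1 t0 F0 tF; have [t1|t1] := leP t 1; first by lra.
have : t <= t `^ p by rewrite le1r_powR// ltW.
lra.
Qed.

Lemma sqn_add_le (R : realType) (n : nat) (v w : 'rV[R]_n) :
  sqn (v + w) <= 2 * sqn v + 2 * sqn w.
Proof.
rewrite /sqn !mulr_sumr -big_split/=; apply: ler_sum => i _; rewrite mxE.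
by have := sqr_ge0 (v 0 i - w 0 i); lra.
Qed.

(** At a maximum [(x0, y0)] of [u x - v y - |x - y|^2 / (2 * sqrt eps)] in the
    interior, both equations hold with the same gradient [P], whose powers cancel.
    The diffusion term costs [n * sqrt eps].  The subsolution inequality bounds
    [P], so [|x0 - y0|] has order [sqrt eps] and the Lipschitz constant of [f]
    controls the rest.  If [x0] is on the boundary the maximum is at most [0],
    because [u <= f = 0 <= v] there. *)
Lemma large_solution_lower_bound (R : realType) (n : nat) (Om : set 'rV[R]_n)
    (p eps L F : R) (f u v : 'rV[R]_n -> R) :
  open Om -> bounded_set Om -> 1 < p -> 0 < eps -> 0 <= L -> 0 <= F ->
  (forall x, closure Om x -> 0 <= f x) -> (forall x, closure Om x -> f x <= F) ->
  (forall x y, closure Om x -> closure Om y -> f x <= f y + L * enorm (x - y)) ->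
  (forall x, boundary Om x -> f x = 0) ->
  {within closure Om, continuous u} -> viscosity_subsolution Om p f u ->
  (forall x, closure Om x -> 0 <= u x) -> (forall x, closure Om x -> u x <= f x) ->
  is_PDE_eps_solution Om p f eps v ->
  forall x, Om x -> u x - v x <= (L * (1 + F) + n%:R) * Num.sqrt eps.
Proof.
move=> oOm bOm p1 eps0 L0 F0 f0 fF fL fb cu sub u0 uf sol x Omx.
have clO y : Om y -> closure Om y by exact: subset_closure.
have v0 := large_solution_ge0 oOm bOm (fun y Omy => f0 y (clO y Omy)) p1 eps0 sol.
have [delta d0 dP] := blowup_near_complement F oOm sol.
have [C2v pde _] := sol.
pose K := [set y | forall b, ~ Om b -> delta <= enorm (y - b)].
have KOm y : K y -> Om y.
  move=> yP; apply: contrapT => /yP.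
  by rewrite subrr /enorm -/(sqn _) sqn0 sqrtr0 leNgt d0.
have nK y : Om y -> ~ K y -> F < v y.
  move=> Omy /existsNP[b /not_implyP[nOmb /negP]]; rewrite -ltNge; exact: dP.
set sg := Num.sqrt eps.
have sg0 : 0 < sg by rewrite sqrtr_gt0.
have sge : sg ^+ 2 = eps by rewrite sqr_sqrtr// ltW.
have C0 : 0 <= (L * (1 + F) + n%:R) * sg.
  apply: mulr_ge0; last exact: ltW.
  by apply: addr_ge0 => //; apply: mulr_ge0; lra.
(* Outside the compact set [K] the blow-up of [v] alone gives [u < v]. *)
have [Kx|/(nK _ Omx) vx] := pselect (K x); last first.
  by have := uf x (clO _ Omx); have := fF x (clO _ Omx); lra.
pose k := (2 * sg)^-1.
have k2 : 2 * k * sg = 1 by rewrite /k; field; rewrite gt_eqF.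
have k0 : 0 < k by rewrite invr_gt0; lra.
have cv : {within K, continuous v}.
  by apply: continuous_in_subspaceT => y; rewrite inE => /KOm; exact: C2_continuous.
have [x0 [y0 [clx0 Ky0 mx]]] := @doubling_max R n (closure Om) K u v k
  (ex_intro _ x (clO _ Omx)) (ex_intro _ x Kx) (compact_closure_bounded bOm)
  (compact_inner bOm d0) cu cv.
have Omy0 := KOm _ Ky0.
have mx1 : u x - v x <= u x0 - v y0 - k * sqn (x0 - y0).
  by have := mx x x (clO _ Omx) Kx; rewrite subrr sqn0 mulr0 subr0.
have [neg|pos] := ltP (u x0 - v y0 - k * sqn (x0 - y0)) 0; first by lra.
have ks : 0 <= k * sqn (x0 - y0) by rewrite mulr_ge0 ?sqn_ge0// ltW.
have [Omx0|nOmx0] := pselect (Om x0); last first.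
  have bx0 : boundary Om x0 by split=> // /interior_subset.
  by have := uf _ clx0; rewrite (fb _ bx0); have := v0 _ Omy0; lra.
set P := (2 * k) *: (x0 - y0).
have subx : u x0 + enorm P `^ p - f x0 <= 0.
  have := sub _ (@C1_quadratic R n Om k y0) x0 Omx0; rewrite grad_quadratic; apply.
  by move=> w Omw; have := mx w y0 (clO _ Omw) Ky0; lra.
have mn : \forall y \near y0,
    -1 * (v y - - k * sqn (y - x0)) <= -1 * (v y0 - - k * sqn (y0 - x0)).
  have nOm := open_nbhs_nbhs (conj oOm Omy0).
  near=> y; have Omy : Om y by near: y.
  rewrite -(sqnN (y - x0)) -(sqnN (y0 - x0)) !opprB.
  have [Ky|/(nK _ Omy) vy] := pselect (K y).
    by have := mx x0 y clx0 Ky; lra.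
  have : 0 <= k * sqn (x0 - y) by rewrite mulr_ge0 ?sqn_ge0// ltW.
  by have := uf _ clx0; have := fF _ clx0; lra.
have N1 : -1 != 0 :> R by rewrite oppr_eq0 oner_eq0.
have [gE lE] := quadratic_touching oOm C2v Omy0 N1 mn.
have gP : grad v y0 = P by rewrite gE /P; apply/rowP => i; rewrite !mxE; ring.
have := pde _ Omy0; rewrite gP => pdey.
have lap : - (n%:R * sg) <= eps * laplacian v y0.
  have -> : - (n%:R * sg) = eps * - (2 * n%:R * k).
    transitivity (2 * k * sg * - (n%:R * sg)); first by rewrite k2 mul1r.
    by rewrite -sge; ring.
  by rewrite ler_pM2l//; lra.
have PF : enorm P <= 1 + F.
  apply: (powR_le_bound p1) => //; first exact: enorm_ge0.
  by have := u0 _ clx0; have := fF _ clx0; lra.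
have xy : enorm (x0 - y0) <= (1 + F) * sg.
  rewrite enormZ in PF; last by rewrite mulr_ge0// ltW.
  have : 2 * k * enorm (x0 - y0) * sg <= (1 + F) * sg by rewrite ler_pM2r.
  by rewrite mulrAC k2 mul1r.
have := fL x0 y0 clx0 (clO _ Omy0).
have : L * enorm (x0 - y0) <= L * ((1 + F) * sg) by rewrite ler_wpM2l.
lra.
Unshelve. all: by end_near. Qed.

(** The same doubling with the roles exchanged.  The supersolution property of [u]
    holds up to the boundary, so [y0] is unconstrained.  The variable [x] is kept
    at distance [eta] from the complement.  If the maximum is reached within
    [2 * eta] of the complement, the bound [Z] on [v] concludes; otherwise it is a
    local maximum in [x]. *)
Lemma large_solution_upper_bound (R : realType) (n : nat) (Om : set 'rV[R]_n)
    (p eps L F eta Z : R) (f u v : 'rV[R]_n -> R) :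
  open Om -> bounded_set Om -> 1 < p -> 0 < eps -> eps < 1 -> 0 <= L -> 0 <= F ->
  (forall x, closure Om x -> 0 <= f x) -> (forall x, closure Om x -> f x <= F) ->
  (forall x y, closure Om x -> closure Om y -> f x <= f y + L * enorm (x - y)) ->
  {within closure Om, continuous u} -> viscosity_supersolution_closure Om p f u ->
  (forall x, closure Om x -> 0 <= u x) ->
  is_PDE_eps_solution Om p f eps v ->
  0 < eta -> 0 <= Z ->
  (forall x y, Om x -> ~ Om y -> enorm (x - y) < 2 * eta ->
    (forall b, ~ Om b -> eta <= enorm (x - b)) -> v x <= Z) ->
  forall x, (forall b, ~ Om b -> eta <= enorm (x - b)) ->
    v x - u x <= Z + (L * (1 + F + n%:R) + n%:R) * Num.sqrt eps.
Proof.
move=> oOm bOm p1 eps0 eps1 L0 F0 f0 fF fL cu super u0 sol eta0 Z0 zone x Kx.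
have clO y : Om y -> closure Om y by exact: subset_closure.
have v0 := large_solution_ge0 oOm bOm (fun y Omy => f0 y (clO y Omy)) p1 eps0 sol.
have [C2v pde _] := sol.
pose K := [set y | forall b, ~ Om b -> eta <= enorm (y - b)].
have KOm y : K y -> Om y.
  move=> yP; apply: contrapT => /yP.
  by rewrite subrr /enorm -/(sqn _) sqn0 sqrtr0 leNgt eta0.
have Omx := KOm _ Kx.
set sg := Num.sqrt eps.
have sg0 : 0 < sg by rewrite sqrtr_gt0.
have sge : sg ^+ 2 = eps by rewrite sqr_sqrtr// ltW.
have sg1 : sg <= 1 by nra.
have nR : 0 <= n%:R :> R by [].
have C0 : 0 <= (L * (1 + F + n%:R) + n%:R) * sg.
  apply: mulr_ge0; last exact: ltW.
  by apply: addr_ge0 => //; apply: mulr_ge0; lra.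
pose k := (2 * sg)^-1.
have k2 : 2 * k * sg = 1 by rewrite /k; field; rewrite gt_eqF.
have k0 : 0 < k by rewrite invr_gt0; lra.
have cv : {within K, continuous v}.
  by apply: continuous_in_subspaceT => y; rewrite inE => /KOm; exact: C2_continuous.
have [x0 [y0 [Kx0 cly0 mx]]] := @doubling_max R n K (closure Om) v u k
  (ex_intro _ x Kx) (ex_intro _ x (clO _ Omx)) (compact_inner bOm eta0)
  (compact_closure_bounded bOm) cv cu.
have Omx0 := KOm _ Kx0.
have mx1 : v x - u x <= v x0 - u y0 - k * sqn (x0 - y0).
  by have := mx x x Kx (clO _ Omx); rewrite subrr sqn0 mulr0 subr0.
have ks : 0 <= k * sqn (x0 - y0) by rewrite mulr_ge0 ?sqn_ge0// ltW.
have [[y [nOmy xy]]|far] := pselect (exists y, ~ Om y /\ enorm (x0 - y) < 2 * eta).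
  by have := zone x0 y Omx0 nOmy xy Kx0; have := u0 _ cly0; lra.
have far' y : ~ Om y -> 2 * eta <= enorm (x0 - y).
  by move=> nOmy; rewrite leNgt; apply/negP => H; apply: far; exists y.
set P := (2 * k) *: (x0 - y0).
have supy : 0 <= u y0 + enorm P `^ p - f y0.
  have := super _ _ (@C1_closure_quadratic R n Om (- k) x0) y0 cly0.
  have -> : (2 * - k) *: (y0 - x0) = P.
    by rewrite /P; apply/rowP => i; rewrite !mxE; ring.
  apply=> w clw; have := mx x0 w Kx0 clw.
  by rewrite -(sqnN (x0 - w)) -(sqnN (x0 - y0)) !opprB; lra.
have mn : \forall y \near x0,
    1 * (v y - k * sqn (y - y0)) <= 1 * (v x0 - k * sqn (x0 - y0)).
  have c0 : \forall y \near x0, sqn (y - x0) < eta ^+ 2.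
    have := @sqn_sub_continuous R n x0 x0; rewrite /continuous_at subrr sqn0 => c.
    by apply: (cvgr_lt 0 c); rewrite exprn_gt0.
  near=> y; rewrite !mul1r.
  have yx0 : sqn (y - x0) < eta ^+ 2 by near: y.
  have Ky : K y.
    move=> b nOmb; have := far' b nOmb => H.
    have : (2 * eta) ^+ 2 <= sqn (x0 - b).
      by rewrite -enorm_sqr ler_pXn2r ?nnegrE ?enorm_ge0//; lra.
    have := sqn_add_le (x0 - y) (y - b); rewrite subrKA.
    rewrite -(sqnN (x0 - y)) opprB => H1 H2.
    rewrite leNgt; apply/negP => H3.
    have : sqn (y - b) <= eta ^+ 2 by rewrite -enorm_le ?ltW.
    by lra.
  by have := mx y y0 Ky cly0; lra.
have [gE lE] := quadratic_touching oOm C2v Omx0 (oner_neq0 _) mn.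
have := pde _ Omx0; rewrite gE -/P => pdex.
have lap : eps * laplacian v x0 <= n%:R * sg.
  have -> : n%:R * sg = eps * (2 * n%:R * k).
    transitivity (2 * k * sg * (n%:R * sg)); first by rewrite k2 mul1r.
    by rewrite -sge; ring.
  by rewrite ler_pM2l//; lra.
have PF : enorm P <= 1 + (F + n%:R).
  apply: (powR_le_bound p1); [exact: enorm_ge0|lra|].
  have : n%:R * sg <= n%:R * 1 by rewrite ler_wpM2l.
  by have := v0 _ Omx0; have := fF _ (clO _ Omx0); lra.
have xy : enorm (x0 - y0) <= (1 + F + n%:R) * sg.
  rewrite enormZ in PF; last by rewrite mulr_ge0// ltW.
  have : 2 * k * enorm (x0 - y0) * sg <= (1 + (F + n%:R)) * sg by rewrite ler_pM2r.
  by rewrite mulrAC k2 mul1r addrA.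
have := fL x0 y0 (clO _ Omx0) cly0.
have : L * enorm (x0 - y0) <= L * ((1 + F + n%:R) * sg) by rewrite ler_wpM2l.
lra.
Unshelve. all: by end_near. Qed.

(** * The boundary zone *)

Lemma layer_decr (R : realType) (n : nat) (p c eps h h' : R) :
  1 < p -> 0 < c -> 0 < eps -> 0 < h -> h <= h' ->
  layer n p c eps h' <= layer n p c eps h.
Proof.
move=> p1 c0 e0 h0 hh'; have N0 := layer_dim_gt0 n p1.
have h'0 : 0 < h' by exact: lt_le_trans h0 hh'.
rewrite /layer; case: ifPn => [p2'|_]; last first.
  by rewrite ler_pM2l ?mulr_gt0// lerN2 ler_ln.
have al0 : 0 < (2 - p) / (p - 1) by rewrite divr_gt0 ?subr_gt0.
apply: ler_wpM2l; first by rewrite divr_ge0 ?(ltW al0)// mulr_ge0 ?powR_ge0.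
apply: ler_wpM2l; first exact: powR_ge0.
rewrite !powRN lef_pV2 ?posrE ?powR_gt0//.
by apply: ge0_ler_powR; rewrite ?nnegrE// ltW.
Qed.

(** The exponents work out to [eps^((b + 1) / 2)] with [b > 0] when [p < 2]; when
    [p = 2] the logarithm is absorbed by one of the two factors [sqrt eps]. *)
Lemma layer_sqrt_le (R : realType) (n : nat) (p c kappa : R) :
  1 < p -> p <= 2 -> 0 < c -> 0 < kappa ->
  exists2 C : R, 0 <= C & forall eps, 0 < eps -> eps < 1 ->
    layer n p c eps (kappa * Num.sqrt eps) <= C * Num.sqrt eps.
Proof.
move=> p1 p2 c0 k0; have N0 := layer_dim_gt0 n p1.
set N := layer_dim n p in N0 *; set b := layer_exponent p.
have pm : 0 < p - 1 by lra.
have b0 : 0 < b by rewrite invr_gt0.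
have [p2'|p2'] := ltP p 2.
  pose alpha := (2 - p) / (p - 1).
  have al0 : 0 < alpha by rewrite divr_gt0 ?subr_gt0.
  have bE : b = alpha + 1 by rewrite /b /layer_exponent /alpha; field; rewrite gt_eqF.
  pose C := N `^ b * c `^ (- alpha) / alpha * kappa `^ (- alpha).
  have C0 : 0 <= C by rewrite mulr_ge0 ?powR_ge0// divr_ge0 ?(ltW al0)// mulr_ge0 ?powR_ge0.
  exists C => // eps e0 e1; set sg := Num.sqrt eps.
  have sg0 : 0 < sg by rewrite sqrtr_gt0.
  have sge : sg ^+ 2 = eps by rewrite sqr_sqrtr// ltW.
  have sg1 : sg <= 1 by nra.
  rewrite /layer p2' -/b -/alpha -/N powRM ?(ltW k0) ?(ltW sg0)//.
  have -> : N `^ b * c `^ (- alpha) / alpha * (eps `^ b * (kappa `^ (- alpha) * sg `^ (- alpha)))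
     = C * (eps `^ b * sg `^ (- alpha)) by rewrite /C; ring.
  apply: ler_wpM2l => //.
  have -> : eps `^ b * sg `^ (- alpha) = sg `^ (b + 1).
    rewrite -sge -powR_mulrn ?(ltW sg0)// -powRrM -powRD; last by rewrite (gt_eqF sg0) implybT.
    by congr (_ `^ _); rewrite bE; ring.
  by apply: ge1r_powR; [rewrite sg0|lra].
have pE : p = 2 by lra.
pose C := N * (`|ln kappa| + 1).
exists C; first by rewrite mulr_ge0 ?(ltW N0)// addr_ge0.
move=> eps e0 e1; set sg := Num.sqrt eps.
have sg0 : 0 < sg by rewrite sqrtr_gt0.
have sge : sg ^+ 2 = eps by rewrite sqr_sqrtr// ltW.
have sg1 : sg <= 1 by nra.
rewrite /layer ltNge p2'/= -/N lnM ?posrE//.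
have lk := ler_norm (- ln kappa); rewrite normrN in lk.
have ls : sg * - ln sg <= 1.
  have : ln sg^-1 < sg^-1 by apply: ln_sublinear; rewrite invr_gt0.
  rewrite lnV ?posrE// => H.
  have : sg * - ln sg <= sg * sg^-1 by rewrite ler_pM2l// ltW.
  by rewrite mulfV// gt_eqF.
have -> : eps * N * - (ln kappa + ln sg) = N * (sg * (sg * - ln kappa + sg * - ln sg)).
  by rewrite -sge; ring.
rewrite /C -mulrA ler_pM2l// [leRHS]mulrC ler_pM2l//.
have : sg * - ln kappa <= 1 * `|ln kappa|.
  apply: (@le_trans _ _ (sg * `|ln kappa|)); first by rewrite ler_pM2l.
  by rewrite ler_wpM2r.
lra.
Qed.

(** The comparison is carried out on an interior ball of radius [c * sqrt eps].
    Since [f] vanishes on the boundary and is Lipschitz, it has order [sqrt eps]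
    on that ball. *)
Lemma zone_bound (R : realType) (n : nat) (Om : set 'rV[R]_n)
    (p eps L c : R) (f v d : 'rV[R]_n -> R) (x y : 'rV[R]_n) :
  open Om -> 1 < p -> p <= 2 -> 0 < eps -> eps < 1 -> 0 <= L ->
  (forall x y, closure Om x -> closure Om y -> f x <= f y + L * enorm (x - y)) ->
  (forall x, boundary Om x -> f x = 0) ->
  is_PDE_eps_solution Om p f eps v ->
  0 < c -> c <= 1 -> deep_ball Om d c x ->
  Om x -> ~ Om y -> enorm (x - y) <= c * (c * Num.sqrt eps) ->
  exists h : R, [/\ 0 < h, c * d x <= h, (exists2 y0, ~ Om y0 & enorm (x - y0) <= h) &
    v x <= layer n p c eps h + 3 * L * (c * Num.sqrt eps)
           + layer_excess n p eps (c * Num.sqrt eps)].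
Proof.
move=> oOm p1 p2 e0 e1 L0 fL fb [C2v pde _] c0 c1 deep Omx nOmy xy.
have clO w : Om w -> closure Om w by exact: subset_closure.
set sg := Num.sqrt eps in xy *.
have sg0 : 0 < sg by rewrite sqrtr_gt0.
have sge : sg ^+ 2 = eps by rewrite sqr_sqrtr// ltW.
have sg1 : sg <= 1 by nra.
have r0 : 0 < c * sg by rewrite mulr_gt0.
have rc : c * sg <= c by nra.
have [z [h [h0 zOm xz dh y0h]]] := deep _ y r0 rc nOmy xy.
exists h; split => //.
have exz := enorm_ge0 (x - z).
have ch0 : 0 < c * h by rewrite mulr_gt0.
have xzr : enorm (x - z) <= c * sg by lra.
have Omz : Om z.
  by apply: zOm; rewrite subrr /enorm -/(sqn _) sqn0 sqrtr0 ltW.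
have [b bb xb] := boundary_point_between oOm Omx nOmy.
have fx : f x <= L * (c * sg).
  have := fL x b (clO _ Omx) bb.1; rewrite (fb _ bb) add0r => H.
  apply: le_trans H _; rewrite ler_wpM2l//; nra.
have fz : f z <= 2 * (L * (c * sg)).
  have := fL z x (clO _ Omz) (clO _ Omx); rewrite enormB.
  have : L * enorm (x - z) <= L * (c * sg) by rewrite ler_wpM2l.
  lra.
have fw w : enorm (w - z) <= c * sg -> f w <= 3 * L * (c * sg).
  move=> wz; have := fL w z (clO _ (zOm _ wz)) (clO _ Omz).
  have : L * enorm (w - z) <= L * (c * sg) by rewrite ler_wpM2l.
  lra.
have F0 : 0 <= 3 * L * (c * sg) by rewrite !mulr_ge0// ltW.
have depth : c * h * (c * sg) <= (c * sg) ^+ 2 - sqn (x - z).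
  rewrite -enorm_sqr; move: (enorm (x - z)) exz xz => e; move: (c * h) ch0 => q.
  by move: (c * sg) => r *; nra.
have [p2'|p2'] := ltP p 2; first exact: (layer_profile_sub oOm C2v pde p1 p2' e0 r0 F0 zOm fw c0 h0 depth).
have pE : p = 2 by lra.
rewrite pE in pde *.
exact: (layer_profile_quad oOm C2v pde e0 sg0 sg1 F0 zOm fw c0 h0 depth).
Qed.

Lemma bounded_of_lipschitz (R : realType) (n : nat) (A : set 'rV[R]_n)
    (f : 'rV[R]_n -> R) (L : R) :
  bounded_set A -> 0 <= L ->
  (forall x y, closure A x -> closure A y -> f x <= f y + L * enorm (x - y)) ->
  exists2 F : R, 0 <= F & forall x, closure A x -> f x <= F.
Proof.
move=> bA L0 fL; have [[a Aa]|A0] := pselect (closure A !=set0); last first.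
  by exists 0 => // x clx; exfalso; apply: A0; exists x.
have [|c _ cP] := compact_EVT_max (ex_intro _ a Aa) (compact_closure_bounded bA)
    (_ : {within closure A, continuous (fun x => enorm (x - a))}).
  apply: continuous_subspaceT => x.
  apply: (@continuous_comp _ _ _ (fun x : 'rV[R]_n => sqn (x - a)) Num.sqrt).
    exact: sqn_sub_continuous.
  exact: sqrt_continuous.
exists (`|f a| + L * enorm (c - a)).
  by rewrite addr_ge0// mulr_ge0// enorm_ge0.
move=> x clx; apply: le_trans (fL x a clx Aa) _.
by rewrite lerD ?ler_norm// ler_wpM2l// cP// inE.
Qed.

(** * The rate of convergence *)

Theorem theorem1p1 (R : realType) (n : nat) (hn : (0 < n)%N)
    (p : R) (hp1 : 1 < p) (hp2 : p <= 2)
    (Om : set 'rV[R]_n) (hopen : open Om) (hbnd : bounded_set Om)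
    (hconn : connected Om) (hC2 : C2_boundary Om)
    (f : 'rV[R]_n -> R)
    (hf0 : forall x, closure Om x -> 0 <= f x)
    (hfL : lipschitz_euclid (closure Om) f)
    (hfb : forall x, boundary Om x -> f x = 0)
    (d : 'rV[R]_n -> R) (hd : is_extended_dist Om d)
    (ueps : R -> 'rV[R]_n -> R)
    (hueps : forall eps : R, 0 < eps -> eps < 1 ->
       is_PDE_eps_solution Om p f eps (ueps eps))
    (u : 'rV[R]_n -> R) (hu : is_PDE0_solution Om p f u) :
  let alpha := (2 - p) / (p - 1) in
  exists C : R, forall eps : R, 0 < eps -> eps < 1 -> forall x, Om x ->
    (p < 2 ->
       - C * Num.sqrt eps <= ueps eps x - u x /\
       ueps eps x - u x <=
         C * (Num.sqrt eps + eps `^ (alpha + 1) / d x `^ alpha)) /\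
    (p = 2 ->
       - C * Num.sqrt eps <= ueps eps x - u x /\
       ueps eps x - u x <= C * (Num.sqrt eps + eps * `|ln (d x)|)).
Proof.
move=> alpha.
have [C2d _ dpos dneg] := hd.
have [L L0 fL] := lipschitz_nonneg hfL.
have [F F0 fF] := bounded_of_lipschitz hbnd L0 fL.
have [c [c0 c1] deep] := uniform_deep_ball hopen hbnd hC2 C2d dpos dneg.
have [cu sub super] := hu.
have u0 := state_constraint_ge0 hbnd hf0 hp1 hu.
have uf := subsolution_le_closure hopen hbnd hfL cu sub.
have kappa0 : 0 < c ^+ 2 / 2 by rewrite divr_gt0// exprn_gt0.
have [CK CK0 excess] := layer_excess_le n hp1 hp2 c0 c1.
have [Cl Cl0 layer_at] := layer_sqrt_le n hp1 hp2 c0 kappa0.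
have clO y : Om y -> closure Om y by exact: subset_closure.
have nR : 0 <= n%:R :> R by [].
pose CZ := 3 * L * c + CK.
have CZ0 : 0 <= CZ by rewrite addr_ge0// !mulr_ge0// ltW.
pose CI := Cl + CZ + (L * (1 + F + n%:R) + n%:R).
have LF : 0 <= L * (1 + F + n%:R) by rewrite mulr_ge0//; lra.
have CI0 : 0 <= CI by rewrite /CI; lra.
pose CL := L * (1 + F) + n%:R.
have CL0 : 0 <= CL by rewrite addr_ge0// mulr_ge0//; lra.
have zone eps x y : 0 < eps -> eps < 1 -> Om x -> ~ Om y ->
    enorm (x - y) <= c * (c * Num.sqrt eps) ->
    exists h, [/\ 0 < h, c * d x <= h, (exists2 y0, ~ Om y0 & enorm (x - y0) <= h) &
      ueps eps x <= layer n p c eps h + CZ * Num.sqrt eps].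
  move=> e0 e1 Omx nOmy xy.
  have [h [h0 dh y0h vh]] := zone_bound hopen hp1 hp2 e0 e1 L0 fL hfb
    (hueps _ e0 e1) c0 c1 (deep _ Omx) Omx nOmy xy.
  exists h; split => //; apply: le_trans vh _.
  by have := excess _ e0 e1; rewrite /CZ; lra.
(* Away from the complement the doubling argument applies, with the zone bound at
   depth of order [sqrt eps] on the edge; close to it the zone bound is used alone,
   since [u] is nonnegative. *)
have upper eps x : 0 < eps -> eps < 1 -> Om x ->
    ueps eps x - u x <= CI * Num.sqrt eps \/
    ueps eps x - u x <= layer n p c eps (c * d x) + CZ * Num.sqrt eps.
  move=> e0 e1 Omx; set sg := Num.sqrt eps.
  have sg0 : 0 < sg by rewrite sqrtr_gt0.
  have eta0 : 0 < c ^+ 2 / 2 * sg by rewrite mulr_gt0.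
  have [far|] := pselect (forall b, ~ Om b -> c ^+ 2 / 2 * sg <= enorm (x - b)).
    left; have Z0 : 0 <= (Cl + CZ) * sg by rewrite mulr_ge0 ?(ltW sg0)// addr_ge0.
    have := large_solution_upper_bound hopen hbnd hp1 e0 e1 L0 F0 hf0 fF fL cu super
      u0 (hueps _ e0 e1) eta0 Z0 _ far.
    rewrite -/sg => H; rewrite /CI mulrDl; apply: H => x' y' Omx' nOmy' xy' far'.
    have [|h [h0 _ [y0 nOmy0 y0h] vh]] := zone eps x' y' e0 e1 Omx' nOmy'.
      by apply: ltW; apply: lt_le_trans xy' _; rewrite -/sg; lra.
    apply: le_trans vh _; rewrite [leRHS]mulrDl lerD2r; apply: le_trans (layer_at _ e0 e1).
    apply: layer_decr => //; exact: le_trans (far' _ nOmy0) y0h.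
  move=> /existsNP[y /not_implyP[nOmy /negP]]; rewrite -ltNge => xy; right.
  have [|h [h0 dh _ vh]] := zone eps x y e0 e1 Omx nOmy.
    by rewrite -/sg; have := eta0; lra.
  have cd0 : 0 < c * d x by rewrite mulr_gt0// dpos.
  have := @layer_decr R n p c eps _ _ hp1 c0 e0 cd0 dh.
  by have := u0 _ (clO _ Omx); move: vh; rewrite -/sg; lra.
have N0 := layer_dim_gt0 n hp1.
pose A := layer_dim n p `^ layer_exponent p * c `^ (- alpha) / alpha * c `^ (- alpha).
have al0 : 0 <= alpha by apply: divr_ge0; rewrite subr_ge0 ?(ltW hp1).
have A0 : 0 <= A.
  by rewrite mulr_ge0 ?powR_ge0// divr_ge0// mulr_ge0 ?powR_ge0.
pose B := layer_dim n p * (`|ln c| + 1).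
have B0 : 0 <= B by apply: mulr_ge0; [exact: ltW|exact: addr_ge0].
exists (CL + CI + CZ + A + B) => eps e0 e1 x Omx.
set sg := Num.sqrt eps.
have sg0 : 0 < sg by rewrite sqrtr_gt0.
have sge : sg ^+ 2 = eps by rewrite sqr_sqrtr// ltW.
have dx := dpos _ Omx.
have lower : - (CL + CI + CZ + A + B) * sg <= ueps eps x - u x.
  have := large_solution_lower_bound hopen hbnd hp1 e0 L0 F0 hf0 fF fL hfb cu sub u0 uf
    (hueps _ e0 e1) Omx.
  rewrite -/sg -/CL => H.
  have : 0 <= (CI + CZ + A + B) * sg by apply: mulr_ge0; lra.
  lra.
(* [Q] stands for the boundary-layer term of the statement. *)
have absorb Q : 0 <= Q ->
    layer n p c eps (c * d x) <= B * sg + (A + B) * Q ->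
    ueps eps x - u x <= (CL + CI + CZ + A + B) * (sg + Q).
  move=> Q0 lQ.
  have H1 : 0 <= (CL + CI + CZ) * Q by apply: mulr_ge0; lra.
  have H2 : 0 <= (A + B) * Q by apply: mulr_ge0; lra.
  have H3 : 0 <= CL * sg /\ 0 <= CI * sg by split; apply: mulr_ge0 => //; exact: ltW.
  have H4 : 0 <= CZ * sg /\ 0 <= A * sg /\ 0 <= B * sg.
    by split; [|split]; apply: mulr_ge0 => //; exact: ltW.
  by case: (upper eps x e0 e1 Omx); rewrite -/sg; lra.
split=> pE; split => //; apply: absorb.
- by rewrite divr_ge0 ?powR_ge0.
- have -> : layer n p c eps (c * d x) = A * (eps `^ (alpha + 1) / d x `^ alpha).
    rewrite /layer pE -/alpha powRM ?ltW// (powRN (d x)) /A.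
    have -> : alpha + 1 = layer_exponent p.
      by rewrite /alpha /layer_exponent; field; rewrite gt_eqF// subr_gt0.
    ring.
  have H1 : 0 <= B * sg by apply: mulr_ge0 => //; exact: ltW.
  have Q0 : 0 <= eps `^ (alpha + 1) / d x `^ alpha by rewrite divr_ge0 ?powR_ge0.
  have H2 : 0 <= B * (eps `^ (alpha + 1) / d x `^ alpha) by rewrite mulr_ge0.
  lra.
- by rewrite mulr_ge0// ltW.
- rewrite /layer pE ltxx -pE lnM ?posrE//.
  have esg : eps <= sg by nra.
  have H1 : - ln c <= `|ln c| by rewrite -normrN ler_norm.
  have H2 : - ln (d x) <= `|ln (d x)| by rewrite -normrN ler_norm.
  have N1 : 0 <= eps * layer_dim n p by rewrite mulr_ge0// ltW.
  apply: (@le_trans _ _ (eps * layer_dim n p * (`|ln c| + `|ln (d x)|))).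
    by rewrite ler_wpM2l//; lra.
  have : eps * (layer_dim n p * `|ln c|) <= sg * (layer_dim n p * `|ln c|).
    by rewrite ler_wpM2r// mulr_ge0// ltW.
  have Q0 : 0 <= eps * `|ln (d x)| by rewrite mulr_ge0// ltW.
  have H3 : 0 <= A * (eps * `|ln (d x)|) by rewrite mulr_ge0.
  have H4 : 0 <= layer_dim n p * `|ln c| * (eps * `|ln (d x)|).
    by rewrite !mulr_ge0// ltW.
  have H5 : 0 <= layer_dim n p * sg by rewrite mulr_ge0// ltW.
  rewrite /B; lra.
Qed.
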